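(* Let $\tau$ be a primitive type. Suppose $$\emptyset\mid\emptyset\vdash e:\forall\,\mathsf{auth},\mathsf{m}:\star\Rightarrow\star.\ \mathrm{AuthentikitFunc}\ \mathsf{auth}\ \mathsf{m}\to\mathsf{m}\ \tau .$$ Then for every $i\in I$, if $\langle \mathrm{run}_P\,(e\ \_\ \_\ \mathrm{Authentikit}_P),(\emptyset,\emptyset,i)\rangle\to_{cf}^{*}\langle (p,v),\sigma_1\rangle$, there exist states $\sigma_2,\sigma_3$ such that $$\langle \mathrm{run}_V\,(e\ \_\ \_\ \mathrm{Authentikit}_V)\ p,(\emptyset,\emptyset,i)\rangle\to^{*}\langle \mathsf{Some}\,v,\sigma_2\rangle\quad\text{and}\quad\langle \mathrm{run}_I\,(e\ \_\ \_\ \mathrm{Authentikit}_I),(\emptyset,\emptyset,i)\rangle\to^{*}\langle v,\sigma_3\rangle.$$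
   Context: $F^{\omega}_{\mu,\mathrm{ref}}$ is a call-by-value language with higher-order references and an $F^\omega$-style type system (kinds $\star$, $\kappa_1\Rightarrow\kappa_2$; constructors $\mathbf{1},\mathbf{bool},\mathbf{int},\mathbf{string},\times,+,\to,\mathbf{ref},\forall_\kappa,\exists_\kappa,\mu_\kappa$ iso-recursive), untyped terms, and a primitive $\mathsf{hash}:\mathbf{string}\to\mathbf{string}$. $\mathsf{None}/\mathsf{Some}$ are the injections of $\mathbf{1}+\tau$. Hash functions $(\mathrm{hash}_i)_{i\in I}$; states $(m,h,i)$ (heap, hash history, index); $\mathsf{hash}\ s$ steps to $\mathrm{hash}_i(s)$ and adds $s$ to $h$. $\to_{cf}$ is a step whose resulting state has no two distinct history strings with equal $\mathrm{hash}_i$; $\to^*_{cf}$, $\to^*$ reflexive-transitive closures. A primitive type is $\mathbf{1},\mathbf{bool},\mathbf{int},\mathbf{string}$ or a product/sum of primitive types. $\mathrm{AuthentikitFunc} := \lambda\,\mathsf{auth},\mathsf{m}.\ (\forall\alpha.\alpha\to\mathsf{m}\,\alpha)\times(\forall\alpha,\beta.\mathsf{m}\,\alpha\to(\alpha\to\mathsf{m}\,\beta)\to\mathsf{m}\,\beta)\times\mathrm{Authenticatable}$ with $\mathrm{Authenticatable} := \exists\,\mathsf{evi}:\star\Rightarrow\star.\ (\forall\alpha.\mathsf{evi}(\mathsf{auth}\,\alpha))\times(\forall\alpha,\beta.\mathsf{evi}\,\alpha\to\mathsf{evi}\,\beta\to\mathsf{evi}(\alpha\times\beta))\times(\forall\alpha,\beta.\mathsf{evi}\,\alpha\to\mathsf{evi}\,\beta\to\mathsf{evi}(\alpha+\beta))\times\mathsf{evi}\,\mathbf{string}\times\mathsf{evi}\,\mathbf{int}\times(\forall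 f.\mathsf{evi}(f(\mu_\star f))\to\mathsf{evi}(\mu_\star f))\times(\forall\alpha.\mathsf{evi}\,\alpha\to\alpha\to\mathsf{auth}\,\alpha)\times(\forall\alpha.\mathsf{evi}\,\alpha\to\mathsf{auth}\,\alpha\to\mathsf{m}\,\alpha)$ (return, bind, evidence combinators, $\mathrm{auth}$, $\mathrm{unauth}$). All three implementations use the same fixed serialization scheme for strings, ints, pairs, sums, recursive types, and authenticated values (an authenticated value serializes to its hash string); serialization is injective and independent of the type used. Proofs are lists of strings. $\mathrm{Authentikit}_P$ (prover): $\mathsf{auth}\,\alpha=\alpha\times\mathbf{string}$; $\mathsf{m}\,\alpha=\mathbf{1}\to\mathrm{proof}\times\alpha$; $\mathrm{return}\ a\ ()=([\,],a)$; $\mathrm{bind}\ c\ f\ ()$ computes $(p,a)=c\,()$, $(p',b)=f\,a\,()$ and returns $(p\mathbin{+\!\!+}p',b)$; evidence is a serializer, the evidence for $\mathsf{auth}$ maps $(\_,h)$ to $h$; $\mathrm{auth}\ evi\ a=(a,\mathsf{hash}(evi\ a))$; $\mathrm{unauth}\ evi\ (a,\_)\ ()=([evi\ a],a)$; $\mathrm{run}_P\ c=c\,()$. $\mathrm{Authentikit}_V$ (verifier): $\mathsf{auth}\,\alpha=\mathbf{string}$; $\mathsf{m}\,\alpha=\mathrm{proof}\to\mathbf{1}+(\mathrm{proof}\times\alpha)$; $\mathrm{return}\ a\ p=\mathsf{Some}(p,a)$; $\mathrm{bind}$ propagates $\mathsf{None}$ and otherwise passes the remaining proof; evidence is a (serializer,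 deserializer) pair with deserialization inverting serialization; $\mathrm{auth}\ evi\ a=\mathsf{hash}(\mathrm{serialize}\ a)$; $\mathrm{unauth}\ evi\ h\ p$: if $p=s::ps$ and $\mathsf{hash}\,s=h$, return $\mathsf{Some}(ps,a)$ when $\mathrm{deserialize}\ s=\mathsf{Some}\,a$, else $\mathsf{None}$; otherwise $\mathsf{None}$; $\mathrm{run}_V\ c\ p$ returns $\mathsf{Some}\,a$ if $c\,p=\mathsf{Some}(\_,a)$ and $\mathsf{None}$ otherwise. $\mathrm{Authentikit}_I$ (ideal): $\mathsf{auth}\,\alpha=\alpha$, $\mathsf{m}\,\alpha=\mathbf{1}\to\alpha$, $\mathrm{return}\ a\ ()=a$, $\mathrm{bind}\ c\ f\ ()=f\,(c\,())\,()$, $\mathrm{auth}\ \_\ a=a$, $\mathrm{unauth}\ \_\ a\ ()=a$, $\mathrm{run}_I\ c=c\,()$. *)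

(* Defs.v *)
From Stdlib Require Import List String Ascii ZArith Bool.
From Stdlib Require Import Strings.BinaryString.
Import ListNotations.
Open Scope string_scope.

Inductive kind : Type :=
  | KStar : kind
  | KArr : kind -> kind -> kind.

Inductive ty : Type :=
  | TVar : nat -> ty
  | TUnit : ty
  | TBool : ty
  | TInt : ty
  | TString : ty
  | TProd : ty -> ty -> ty
  | TSum : ty -> ty -> ty
  | TArr : ty -> ty -> ty
  | TRef : ty -> ty
  | TForall : kind -> ty -> ty      (* forall_k, binds TVar 0 *)
  | TExists : kind -> ty -> ty      (* exists_k, binds TVar 0 *)
  | TMu : kind -> ty -> ty          (* mu_k (iso-recursive), binds TVar 0 *)
  | TLam : kind -> ty -> ty         (* type-level lambda, binds TVar 0 *)
  | TApp : ty -> ty -> ty.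

Definition up_ren (r : nat -> nat) : nat -> nat :=
  fun n => match n with 0 => 0 | S n => S (r n) end.

Fixpoint tren (r : nat -> nat) (t : ty) : ty :=
  match t with
  | TVar n => TVar (r n)
  | TUnit => TUnit | TBool => TBool | TInt => TInt | TString => TString
  | TProd a b => TProd (tren r a) (tren r b)
  | TSum a b => TSum (tren r a) (tren r b)
  | TArr a b => TArr (tren r a) (tren r b)
  | TRef a => TRef (tren r a)
  | TForall k a => TForall k (tren (up_ren r) a)
  | TExists k a => TExists k (tren (up_ren r) a)
  | TMu k a => TMu k (tren (up_ren r) a)
  | TLam k a => TLam k (tren (up_ren r) a)
  | TApp a b => TApp (tren r a) (tren r b)
  end.

Definition tshift (t : ty) : ty := tren S t.

Definition up_sub (s : nat -> ty) : nat -> ty :=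
  fun n => match n with 0 => TVar 0 | S n => tshift (s n) end.

Fixpoint tsubst (s : nat -> ty) (t : ty) : ty :=
  match t with
  | TVar n => s n
  | TUnit => TUnit | TBool => TBool | TInt => TInt | TString => TString
  | TProd a b => TProd (tsubst s a) (tsubst s b)
  | TSum a b => TSum (tsubst s a) (tsubst s b)
  | TArr a b => TArr (tsubst s a) (tsubst s b)
  | TRef a => TRef (tsubst s a)
  | TForall k a => TForall k (tsubst (up_sub s) a)
  | TExists k a => TExists k (tsubst (up_sub s) a)
  | TMu k a => TMu k (tsubst (up_sub s) a)
  | TLam k a => TLam k (tsubst (up_sub s) a)
  | TApp a b => TApp (tsubst s a) (tsubst s b)
  end.

Definition tsubst1 (t u : ty) : ty :=
  tsubst (fun n => match n with 0 => u | S n => TVar n end) t.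

Fixpoint tapps (t : ty) (args : list ty) : ty :=
  match args with [] => t | a :: args => tapps (TApp t a) args end.

Inductive kinded : list kind -> ty -> kind -> Prop :=
  | K_Var D n k : nth_error D n = Some k -> kinded D (TVar n) k
  | K_Unit D : kinded D TUnit KStar
  | K_Bool D : kinded D TBool KStar
  | K_Int D : kinded D TInt KStar
  | K_String D : kinded D TString KStar
  | K_Prod D a b : kinded D a KStar -> kinded D b KStar -> kinded D (TProd a b) KStar
  | K_Sum D a b : kinded D a KStar -> kinded D b KStar -> kinded D (TSum a b) KStar
  | K_Arr D a b : kinded D a KStar -> kinded D b KStar -> kinded D (TArr a b) KStar
  | K_Ref D a : kinded D a KStar -> kinded D (TRef a) KStar
  | K_Forall D k a : kinded (k :: D) a KStar -> kinded D (TForall k a) KStar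
  | K_Exists D k a : kinded (k :: D) a KStar -> kinded D (TExists k a) KStar
  | K_Mu D k a : kinded (k :: D) a k -> kinded D (TMu k a) k
  | K_Lam D k k' a : kinded (k :: D) a k' -> kinded D (TLam k a) (KArr k k')
  | K_App D k k' a b :
      kinded D a (KArr k k') -> kinded D b k -> kinded D (TApp a b) k'.

Inductive teq : ty -> ty -> Prop :=
  | teq_refl t : teq t t
  | teq_sym t u : teq t u -> teq u t
  | teq_trans t u w : teq t u -> teq u w -> teq t w
  | teq_beta k t u : teq (TApp (TLam k t) u) (tsubst1 t u)
  | teq_Prod a a' b b' : teq a a' -> teq b b' -> teq (TProd a b) (TProd a' b')
  | teq_Sum a a' b b' : teq a a' -> teq b b' -> teq (TSum a b) (TSum a' b')
  | teq_Arr a a' b b' : teq a a' -> teq b b' -> teq (TArr a b) (TArr a' b')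
  | teq_Ref a a' : teq a a' -> teq (TRef a) (TRef a')
  | teq_Forall k a a' : teq a a' -> teq (TForall k a) (TForall k a')
  | teq_Exists k a a' : teq a a' -> teq (TExists k a) (TExists k a')
  | teq_Mu k a a' : teq a a' -> teq (TMu k a) (TMu k a')
  | teq_Lam k a a' : teq a a' -> teq (TLam k a) (TLam k a')
  | teq_App a a' b b' : teq a a' -> teq b b' -> teq (TApp a b) (TApp a' b').

Inductive primitive : ty -> Prop :=
  | prim_unit : primitive TUnit
  | prim_bool : primitive TBool
  | prim_int : primitive TInt
  | prim_string : primitive TString
  | prim_prod a b : primitive a -> primitive b -> primitive (TProd a b)
  | prim_sum a b : primitive a -> primitive b -> primitive (TSum a b).

Definition loc := nat.

Inductive lit : Type :=
  | LUnit : lit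
  | LBool : bool -> lit
  | LInt : Z -> lit
  | LString : string -> lit
  | LLoc : loc -> lit.

Definition lit_eq_dec (l1 l2 : lit) : {l1 = l2} + {l1 <> l2}.
Proof. decide equality; auto using bool_dec, Z.eq_dec, string_dec, Nat.eq_dec. Defined.

Inductive binder : Type := BAnon | BNamed (x : string).

Inductive un_op : Type :=
  | NotOp | NegOp | StrLenOp | IntToStrOp | StrToIntOp.

Inductive bin_op : Type :=
  | PlusOp | MinusOp | MultOp | LtOp | LeOp | EqOp | ConcatOp.

Inductive expr : Type :=
  | Val (v : val)
  | Var (x : string)
  | Rec (f x : binder) (e : expr)
  | App (e1 e2 : expr)
  | UnOp (op : un_op) (e : expr)
  | BinOp (op : bin_op) (e1 e2 : expr)
  | Substr (e1 e2 e3 : expr)           (* substring s start length *)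
  | If (e0 e1 e2 : expr)
  | Pair (e1 e2 : expr)
  | Fst (e : expr)
  | Snd (e : expr)
  | InjL (e : expr)
  | InjR (e : expr)
  | Case (e0 e1 e2 : expr)             (* e1, e2 evaluate to functions *)
  | Fold (e : expr)
  | Unfold (e : expr)
  | TLamE (e : expr)
  | TAppE (e : expr)
  | Pack (e : expr)
  | Unpack (e1 : expr) (x : binder) (e2 : expr)
  | Alloc (e : expr)
  | Deref (e : expr)
  | Store (e1 e2 : expr)
  | Hash (e : expr)
with val : Type :=
  | LitV (l : lit)
  | RecV (f x : binder) (e : expr)
  | PairV (v1 v2 : val)
  | InjLV (v : val)
  | InjRV (v : val)
  | FoldV (v : val)
  | TLamV (e : expr)
  | PackV (v : val).

Definition binder_is (x : string) (b : binder) : bool :=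
  match b with BAnon => false | BNamed y => if string_dec x y then true else false end.

(* substitution of a (closed) value for a variable *)
Fixpoint subst (x : string) (v : val) (e : expr) : expr :=
  match e with
  | Val w => Val w
  | Var y => if string_dec x y then Val v else Var y
  | Rec f y b =>
      Rec f y (if binder_is x f || binder_is x y then b else subst x v b)
  | App e1 e2 => App (subst x v e1) (subst x v e2)
  | UnOp op e1 => UnOp op (subst x v e1)
  | BinOp op e1 e2 => BinOp op (subst x v e1) (subst x v e2)
  | Substr e1 e2 e3 => Substr (subst x v e1) (subst x v e2) (subst x v e3)
  | If e0 e1 e2 => If (subst x v e0) (subst x v e1) (subst x v e2)
  | Pair e1 e2 => Pair (subst x v e1) (subst x v e2)
  | Fst e1 => Fst (subst x v e1)
  | Snd e1 => Snd (subst x v e1)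
  | InjL e1 => InjL (subst x v e1)
  | InjR e1 => InjR (subst x v e1)
  | Case e0 e1 e2 => Case (subst x v e0) (subst x v e1) (subst x v e2)
  | Fold e1 => Fold (subst x v e1)
  | Unfold e1 => Unfold (subst x v e1)
  | TLamE e1 => TLamE (subst x v e1)
  | TAppE e1 => TAppE (subst x v e1)
  | Pack e1 => Pack (subst x v e1)
  | Unpack e1 y e2 =>
      Unpack (subst x v e1) y (if binder_is x y then e2 else subst x v e2)
  | Alloc e1 => Alloc (subst x v e1)
  | Deref e1 => Deref (subst x v e1)
  | Store e1 e2 => Store (subst x v e1) (subst x v e2)
  | Hash e1 => Hash (subst x v e1)
  end.

Definition subst' (b : binder) (v : val) (e : expr) : expr :=
  match b with BAnon => e | BNamed x => subst x v e end.

(* integer <-> string conversion (binary notation, canonical forms only) *)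
Definition int_to_string (z : Z) : string := BinaryString.of_Z z.
Definition string_to_int (s : string) : option Z :=
  let z := BinaryString.to_Z s in
  if string_dec (BinaryString.of_Z z) s then Some z else None.

Definition un_op_eval (op : un_op) (v : val) : option val :=
  match op, v with
  | NotOp, LitV (LBool b) => Some (LitV (LBool (negb b)))
  | NegOp, LitV (LInt n) => Some (LitV (LInt (- n)))
  | StrLenOp, LitV (LString s) => Some (LitV (LInt (Z.of_nat (String.length s))))
  | IntToStrOp, LitV (LInt n) => Some (LitV (LString (int_to_string n)))
  | StrToIntOp, LitV (LString s) =>
      Some (match string_to_int s with
            | None => InjLV (LitV LUnit)
            | Some n => InjRV (LitV (LInt n))
            end)
  | _, _ => None
  end.

Definition bin_op_eval (op : bin_op) (v1 v2 : val) : option val :=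
  match op, v1, v2 with
  | PlusOp, LitV (LInt a), LitV (LInt b) => Some (LitV (LInt (a + b)))
  | MinusOp, LitV (LInt a), LitV (LInt b) => Some (LitV (LInt (a - b)))
  | MultOp, LitV (LInt a), LitV (LInt b) => Some (LitV (LInt (a * b)))
  | LtOp, LitV (LInt a), LitV (LInt b) => Some (LitV (LBool (Z.ltb a b)))
  | LeOp, LitV (LInt a), LitV (LInt b) => Some (LitV (LBool (Z.leb a b)))
  | EqOp, LitV l1, LitV l2 =>
      Some (LitV (LBool (if lit_eq_dec l1 l2 then true else false)))
  | ConcatOp, LitV (LString a), LitV (LString b) => Some (LitV (LString (a ++ b)))
  | _, _, _ => None
  end.

Record state (I : Type) : Type := mkState {
  st_heap : loc -> option val;
  st_hist : list string;
  st_idx : I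
}.
Arguments mkState {I}.
Arguments st_heap {I}.
Arguments st_hist {I}.
Arguments st_idx {I}.

Definition init_state {I : Type} (i : I) : state I :=
  mkState (fun _ => None) [] i.

Definition heap_upd (m : loc -> option val) (l : loc) (v : val) : loc -> option val :=
  fun l' => if Nat.eq_dec l l' then Some v else m l'.

Definition unitV : val := LitV LUnit.

Inductive head_step {I : Type} (hashf : I -> string -> string) :
    expr -> state I -> expr -> state I -> Prop :=
  | RecS f x e σ : head_step hashf (Rec f x e) σ (Val (RecV f x e)) σ
  | PairS v1 v2 σ : head_step hashf (Pair (Val v1) (Val v2)) σ (Val (PairV v1 v2)) σ
  | InjLS v σ : head_step hashf (InjL (Val v)) σ (Val (InjLV v)) σ
  | InjRS v σ : head_step hashf (InjR (Val v)) σ (Val (InjRV v)) σ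
  | FoldS v σ : head_step hashf (Fold (Val v)) σ (Val (FoldV v)) σ
  | PackS v σ : head_step hashf (Pack (Val v)) σ (Val (PackV v)) σ
  | TLamS e σ : head_step hashf (TLamE e) σ (Val (TLamV e)) σ
  | BetaS f x e v σ :
      head_step hashf (App (Val (RecV f x e)) (Val v)) σ
        (subst' x v (subst' f (RecV f x e) e)) σ
  | UnOpS op v w σ : un_op_eval op v = Some w ->
      head_step hashf (UnOp op (Val v)) σ (Val w) σ
  | BinOpS op v1 v2 w σ : bin_op_eval op v1 v2 = Some w ->
      head_step hashf (BinOp op (Val v1) (Val v2)) σ (Val w) σ
  | SubstrS s a b σ :
      head_step hashf
        (Substr (Val (LitV (LString s))) (Val (LitV (LInt a))) (Val (LitV (LInt b)))) σ
        (Val (LitV (LString (String.substring (Z.to_nat a) (Z.to_nat b) s)))) σ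
  | IfTrueS e1 e2 σ : head_step hashf (If (Val (LitV (LBool true))) e1 e2) σ e1 σ
  | IfFalseS e1 e2 σ : head_step hashf (If (Val (LitV (LBool false))) e1 e2) σ e2 σ
  | FstS v1 v2 σ : head_step hashf (Fst (Val (PairV v1 v2))) σ (Val v1) σ
  | SndS v1 v2 σ : head_step hashf (Snd (Val (PairV v1 v2))) σ (Val v2) σ
  | CaseLS v e1 e2 σ : head_step hashf (Case (Val (InjLV v)) e1 e2) σ (App e1 (Val v)) σ
  | CaseRS v e1 e2 σ : head_step hashf (Case (Val (InjRV v)) e1 e2) σ (App e2 (Val v)) σ
  | UnfoldS v σ : head_step hashf (Unfold (Val (FoldV v))) σ (Val v) σ
  | TAppS e σ : head_step hashf (TAppE (Val (TLamV e))) σ e σ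
  | UnpackS v x e σ : head_step hashf (Unpack (Val (PackV v)) x e) σ (subst' x v e) σ
  | AllocS v l m h i : m l = None ->
      head_step hashf (Alloc (Val v)) (mkState m h i)
        (Val (LitV (LLoc l))) (mkState (heap_upd m l v) h i)
  | DerefS l v m h i : m l = Some v ->
      head_step hashf (Deref (Val (LitV (LLoc l)))) (mkState m h i) (Val v) (mkState m h i)
  | StoreS l v w m h i : m l = Some w ->
      head_step hashf (Store (Val (LitV (LLoc l))) (Val v)) (mkState m h i)
        (Val unitV) (mkState (heap_upd m l v) h i)
  | HashS s m h i :
      head_step hashf (Hash (Val (LitV (LString s)))) (mkState m h i)
        (Val (LitV (LString (hashf i s)))) (mkState m (s :: h) i).

Inductive ectx_item : Type :=
  | AppLCtx (e2 : expr) | AppRCtx (v1 : val)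
  | UnOpCtx (op : un_op)
  | BinOpLCtx (op : bin_op) (e2 : expr) | BinOpRCtx (op : bin_op) (v1 : val)
  | Substr1Ctx (e2 e3 : expr) | Substr2Ctx (v1 : val) (e3 : expr)
  | Substr3Ctx (v1 v2 : val)
  | IfCtx (e1 e2 : expr)
  | PairLCtx (e2 : expr) | PairRCtx (v1 : val)
  | FstCtx | SndCtx | InjLCtx | InjRCtx
  | CaseCtx (e1 e2 : expr)
  | FoldCtx | UnfoldCtx | TAppCtx | PackCtx
  | UnpackCtx (x : binder) (e2 : expr)
  | AllocCtx | DerefCtx
  | StoreLCtx (e2 : expr) | StoreRCtx (v1 : val)
  | HashCtx.

Definition fill_item (K : ectx_item) (e : expr) : expr :=
  match K with
  | AppLCtx e2 => App e e2
  | AppRCtx v1 => App (Val v1) e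
  | UnOpCtx op => UnOp op e
  | BinOpLCtx op e2 => BinOp op e e2
  | BinOpRCtx op v1 => BinOp op (Val v1) e
  | Substr1Ctx e2 e3 => Substr e e2 e3
  | Substr2Ctx v1 e3 => Substr (Val v1) e e3
  | Substr3Ctx v1 v2 => Substr (Val v1) (Val v2) e
  | IfCtx e1 e2 => If e e1 e2
  | PairLCtx e2 => Pair e e2
  | PairRCtx v1 => Pair (Val v1) e
  | FstCtx => Fst e
  | SndCtx => Snd e
  | InjLCtx => InjL e
  | InjRCtx => InjR e
  | CaseCtx e1 e2 => Case e e1 e2
  | FoldCtx => Fold e
  | UnfoldCtx => Unfold e
  | TAppCtx => TAppE e
  | PackCtx => Pack e
  | UnpackCtx x e2 => Unpack e x e2
  | AllocCtx => Alloc e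
  | DerefCtx => Deref e
  | StoreLCtx e2 => Store e e2
  | StoreRCtx v1 => Store (Val v1) e
  | HashCtx => Hash e
  end.

(* K = [K_inner; ...; K_outer] *)
Definition fill (K : list ectx_item) (e : expr) : expr := fold_left (fun e k => fill_item k e) K e.

Definition cfg (I : Type) : Type := (expr * state I)%type.

Inductive step {I : Type} (hashf : I -> string -> string) : cfg I -> cfg I -> Prop :=
  | step_ctx K e1 e2 σ1 σ2 :
      head_step hashf e1 σ1 e2 σ2 -> step hashf (fill K e1, σ1) (fill K e2, σ2).

Definition collision_free {I : Type} (hashf : I -> string -> string) (σ : state I) : Prop :=
  forall s1 s2, In s1 (st_hist σ) -> In s2 (st_hist σ) -> s1 <> s2 ->
    hashf (st_idx σ) s1 <> hashf (st_idx σ) s2.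

Definition cf_step {I : Type} (hashf : I -> string -> string) (c c' : cfg I) : Prop :=
  step hashf c c' /\ collision_free hashf (snd c').

Inductive rtc {A : Type} (R : A -> A -> Prop) : A -> A -> Prop :=
  | rtc_refl x : rtc R x x
  | rtc_l x y z : R x y -> rtc R y z -> rtc R x z.

Definition tenv := list (string * ty).

Fixpoint lookup (G : tenv) (x : string) : option ty :=
  match G with
  | [] => None
  | (y, t) :: G => if string_dec x y then Some t else lookup G x
  end.

Definition bind_env (b : binder) (t : ty) (G : tenv) : tenv :=
  match b with BAnon => G | BNamed x => (x, t) :: G end.

Definition shift_env (G : tenv) : tenv := map (fun p => (fst p, tshift (snd p))) G.

Definition base_ty (t : ty) : Prop := t = TUnit \/ t = TBool \/ t = TInt \/ t = TString.

Inductive un_op_typed : un_op -> ty -> ty -> Prop :=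
  | NotT : un_op_typed NotOp TBool TBool
  | NegT : un_op_typed NegOp TInt TInt
  | StrLenT : un_op_typed StrLenOp TString TInt
  | IntToStrT : un_op_typed IntToStrOp TInt TString
  | StrToIntT : un_op_typed StrToIntOp TString (TSum TUnit TInt).

Inductive bin_op_typed : bin_op -> ty -> ty -> ty -> Prop :=
  | PlusT : bin_op_typed PlusOp TInt TInt TInt
  | MinusT : bin_op_typed MinusOp TInt TInt TInt
  | MultT : bin_op_typed MultOp TInt TInt TInt
  | LtT : bin_op_typed LtOp TInt TInt TBool
  | LeT : bin_op_typed LeOp TInt TInt TBool
  | EqT t : base_ty t -> bin_op_typed EqOp t t TBool
  | ConcatT : bin_op_typed ConcatOp TString TString TString.

Inductive typed : list kind -> tenv -> expr -> ty -> Prop :=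
  | T_Conv D G e t t' :
      typed D G e t -> teq t t' -> kinded D t' KStar -> typed D G e t'
  | T_Var D G x t : lookup G x = Some t -> typed D G (Var x) t
  | T_Unit D G : typed D G (Val (LitV LUnit)) TUnit
  | T_Bool D G b : typed D G (Val (LitV (LBool b))) TBool
  | T_Int D G n : typed D G (Val (LitV (LInt n))) TInt
  | T_String D G s : typed D G (Val (LitV (LString s))) TString
  | T_Rec D G f x e t1 t2 :
      kinded D t1 KStar -> kinded D t2 KStar ->
      typed D (bind_env f (TArr t1 t2) (bind_env x t1 G)) e t2 ->
      typed D G (Rec f x e) (TArr t1 t2)
  | T_App D G e1 e2 t1 t2 :
      typed D G e1 (TArr t1 t2) -> typed D G e2 t1 -> typed D G (App e1 e2) t2
  | T_UnOp D G op e t1 t2 :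
      un_op_typed op t1 t2 -> typed D G e t1 -> typed D G (UnOp op e) t2
  | T_BinOp D G op e1 e2 t1 t2 t3 :
      bin_op_typed op t1 t2 t3 -> typed D G e1 t1 -> typed D G e2 t2 ->
      typed D G (BinOp op e1 e2) t3
  | T_Substr D G e1 e2 e3 :
      typed D G e1 TString -> typed D G e2 TInt -> typed D G e3 TInt ->
      typed D G (Substr e1 e2 e3) TString
  | T_If D G e0 e1 e2 t :
      typed D G e0 TBool -> typed D G e1 t -> typed D G e2 t -> typed D G (If e0 e1 e2) t
  | T_Pair D G e1 e2 t1 t2 :
      typed D G e1 t1 -> typed D G e2 t2 -> typed D G (Pair e1 e2) (TProd t1 t2)
  | T_Fst D G e t1 t2 : typed D G e (TProd t1 t2) -> typed D G (Fst e) t1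
  | T_Snd D G e t1 t2 : typed D G e (TProd t1 t2) -> typed D G (Snd e) t2
  | T_InjL D G e t1 t2 :
      typed D G e t1 -> kinded D t2 KStar -> typed D G (InjL e) (TSum t1 t2)
  | T_InjR D G e t1 t2 :
      typed D G e t2 -> kinded D t1 KStar -> typed D G (InjR e) (TSum t1 t2)
  | T_Case D G e0 e1 e2 t1 t2 t :
      typed D G e0 (TSum t1 t2) -> typed D G e1 (TArr t1 t) -> typed D G e2 (TArr t2 t) ->
      typed D G (Case e0 e1 e2) t
  | T_Fold D G e k F args :
      typed D G e (tapps (tsubst1 F (TMu k F)) args) ->
      kinded D (tapps (TMu k F) args) KStar ->
      typed D G (Fold e) (tapps (TMu k F) args)
  | T_Unfold D G e k F args :
      typed D G e (tapps (TMu k F) args) ->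
      typed D G (Unfold e) (tapps (tsubst1 F (TMu k F)) args)
  | T_TLam D G e k t :
      typed (k :: D) (shift_env G) e t -> typed D G (TLamE e) (TForall k t)
  | T_TApp D G e k t u :
      typed D G e (TForall k t) -> kinded D u k -> typed D G (TAppE e) (tsubst1 t u)
  | T_Pack D G e k t u :
      kinded (k :: D) t KStar -> kinded D u k -> typed D G e (tsubst1 t u) ->
      typed D G (Pack e) (TExists k t)
  | T_Unpack D G e1 x e2 k t r :
      typed D G e1 (TExists k t) ->
      typed (k :: D) (bind_env x t (shift_env G)) e2 (tshift r) ->
      kinded D r KStar ->
      typed D G (Unpack e1 x e2) r
  | T_Alloc D G e t : typed D G e t -> typed D G (Alloc e) (TRef t)
  | T_Deref D G e t : typed D G e (TRef t) -> typed D G (Deref e) t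
  | T_Store D G e1 e2 t :
      typed D G e1 (TRef t) -> typed D G e2 t -> typed D G (Store e1 e2) TUnit
  | T_Hash D G e : typed D G e TString -> typed D G (Hash e) TString.

Definition proof_ty : ty := TMu KStar (TSum TUnit (TProd TString (TVar 0))).

Definition authenticatable_ty (auth m : ty) : ty :=
  (* under the binder evi = TVar 0 *)
  let auth' := tshift auth in
  let m' := tshift m in
  let evi := TVar 0 in
  TExists (KArr KStar KStar)
   (TProd
     (TForall KStar (TApp (tshift evi) (TApp (tshift auth') (TVar 0))))
   (TProd
     (TForall KStar (TForall KStar
        (TArr (TApp (tshift (tshift evi)) (TVar 1))
        (TArr (TApp (tshift (tshift evi)) (TVar 0))
              (TApp (tshift (tshift evi)) (TProd (TVar 1) (TVar 0)))))))
   (TProd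
     (TForall KStar (TForall KStar
        (TArr (TApp (tshift (tshift evi)) (TVar 1))
        (TArr (TApp (tshift (tshift evi)) (TVar 0))
              (TApp (tshift (tshift evi)) (TSum (TVar 1) (TVar 0)))))))
   (TProd
     (TApp evi TString)
   (TProd
     (TApp evi TInt)
   (TProd
     (TForall (KArr KStar KStar)
        (TArr (TApp (tshift evi)
                    (TApp (TVar 0) (TMu KStar (TApp (TVar 1) (TVar 0)))))
              (TApp (tshift evi) (TMu KStar (TApp (TVar 1) (TVar 0))))))
   (TProd
     (TForall KStar
        (TArr (TApp (tshift evi) (TVar 0))
        (TArr (TVar 0) (TApp (tshift auth') (TVar 0)))))
     (TForall KStar
        (TArr (TApp (tshift evi) (TVar 0))
        (TArr (TApp (tshift auth') (TVar 0)) (TApp (tshift m') (TVar 0)))))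
   ))))))).

Definition authentikit_func_ty (auth m : ty) : ty :=
  TProd
    (TForall KStar (TArr (TVar 0) (TApp (tshift m) (TVar 0))))
  (TProd
    (TForall KStar (TForall KStar
       (TArr (TApp (tshift (tshift m)) (TVar 1))
       (TArr (TArr (TVar 1) (TApp (tshift (tshift m)) (TVar 0)))
             (TApp (tshift (tshift m)) (TVar 0))))))
    (authenticatable_ty auth m)).

(* forall auth m : * => *. AuthentikitFunc auth m -> m tau   (tau closed) *)
Definition client_ty (tau : ty) : ty :=
  TForall (KArr KStar KStar) (TForall (KArr KStar KStar)
    (TArr (authentikit_func_ty (TVar 1) (TVar 0)) (TApp (TVar 0) tau))).

Definition Lam (x : string) (e : expr) : expr := Rec BAnon (BNamed x) e.
Definition LamU (e : expr) : expr := Rec BAnon BAnon e.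
Definition LetE (x : string) (e1 e2 : expr) : expr := App (Lam x e2) e1.
Definition V (x : string) : expr := Var x.
Definition EUnit : expr := Val unitV.
Definition EStr (s : string) : expr := Val (LitV (LString s)).
Definition EInt (n : Z) : expr := Val (LitV (LInt n)).
Definition ENone : expr := InjL EUnit.
Definition ESome (e : expr) : expr := InjR e.
Definition Cat (e1 e2 : expr) : expr := BinOp ConcatOp e1 e2.
Definition EEq (e1 e2 : expr) : expr := BinOp EqOp e1 e2.
Definition App2 (f a b : expr) : expr := App (App f a) b.
Definition App3 (f a b c : expr) : expr := App (App (App f a) b) c.

Definition OptMap (x : string) (body : expr) (o : expr) : expr :=
  Case o (Lam "_" ENone) (Lam x (ESome body)).

Definition HeadIs (c : string) (s : expr) : expr :=
  EEq (Substr s (EInt 0) (EInt 1)) (EStr c).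
Definition Rest (s : expr) : expr :=
  Substr s (EInt 1) (BinOp MinusOp (UnOp StrLenOp s) (EInt 1)).

Definition ENil : expr := Fold (InjL EUnit).
Definition ECons (e es : expr) : expr := Fold (InjR (Pair e es)).

Definition appendE : expr :=
  Rec (BNamed "app") (BNamed "l1")
    (Lam "l2"
      (Case (Unfold (V "l1"))
        (Lam "_" (V "l2"))
        (Lam "c" (ECons (Fst (V "c")) (App2 (V "app") (Snd (V "c")) (V "l2")))))).

(* Serialization scheme (shared by all implementations):
     string s        |-> "S" ++ s
     int n           |-> "I" ++ int_to_string n
     auth value      |-> its hash string
     (a, b)          |-> "P" ++ frame(ser a) ++ frame(ser b)
     inl a / inr b   |-> "L" ++ ser a / "R" ++ ser b
     fold a          |-> ser a
   where frame(s) := int_to_string(|s|) ++ ":" ++ s. *)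
Definition frameE : expr :=
  Lam "s" (Cat (Cat (UnOp IntToStrOp (UnOp StrLenOp (V "s"))) (EStr ":")) (V "s")).

Definition findColonE : expr :=
  Rec (BNamed "find") (BNamed "s")
    (Lam "j"
      (If (BinOp LeOp (UnOp StrLenOp (V "s")) (V "j"))
        ENone
        (If (EEq (Substr (V "s") (V "j") (EInt 1)) (EStr ":"))
          (ESome (V "j"))
          (App2 (V "find") (V "s") (BinOp PlusOp (V "j") (EInt 1)))))).

Definition parseFrameE : expr :=
  Lam "s" (Lam "k"
    (Case (App2 findColonE (V "s") (V "k"))
      (Lam "_" ENone)
      (Lam "j"
        (Case (UnOp StrToIntOp (Substr (V "s") (V "k") (BinOp MinusOp (V "j") (V "k"))))
          (Lam "_" ENone)
          (Lam "n"
            (If (BinOp LeOp (EInt 0) (V "n"))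
              (If (BinOp LeOp (BinOp PlusOp (BinOp PlusOp (V "j") (EInt 1)) (V "n"))
                              (UnOp StrLenOp (V "s")))
                 (ESome (Pair (Substr (V "s") (BinOp PlusOp (V "j") (EInt 1)) (V "n"))
                              (BinOp PlusOp (BinOp PlusOp (V "j") (EInt 1)) (V "n"))))
                 ENone)
              ENone)))))).

Definition tuple8 (a b c d e f g h : expr) : expr :=
  Pair a (Pair b (Pair c (Pair d (Pair e (Pair f (Pair g h)))))).

(*   auth a = a × string,   m a = 1 -> proof × a,  evidence = serializer *)

Definition retP : expr := TLamE (Lam "a" (LamU (Pair ENil (V "a")))).

Definition bindP : expr :=
  TLamE (TLamE (Lam "c" (Lam "f" (LamU
    (LetE "r1" (App (V "c") EUnit)
    (LetE "r2" (App2 (V "f") (Snd (V "r1")) EUnit)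
      (Pair (App2 appendE (Fst (V "r1")) (Fst (V "r2"))) (Snd (V "r2"))))))))).

Definition evi_authP : expr := TLamE (Lam "x" (Snd (V "x"))).
Definition evi_pairP : expr :=
  TLamE (TLamE (Lam "ea" (Lam "eb" (Lam "x"
    (Cat (Cat (EStr "P") (App frameE (App (V "ea") (Fst (V "x")))))
         (App frameE (App (V "eb") (Snd (V "x"))))))))).
Definition evi_sumP : expr :=
  TLamE (TLamE (Lam "ea" (Lam "eb" (Lam "x"
    (Case (V "x")
      (Lam "y" (Cat (EStr "L") (App (V "ea") (V "y"))))
      (Lam "y" (Cat (EStr "R") (App (V "eb") (V "y"))))))))).
Definition evi_stringP : expr := Lam "x" (Cat (EStr "S") (V "x")).
Definition evi_intP : expr := Lam "x" (Cat (EStr "I") (UnOp IntToStrOp (V "x"))).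
Definition evi_muP : expr := TLamE (Lam "e" (Lam "x" (App (V "e") (Unfold (V "x"))))).
Definition authP : expr :=
  TLamE (Lam "e" (Lam "a" (Pair (V "a") (Hash (App (V "e") (V "a")))))).
Definition unauthP : expr :=
  TLamE (Lam "e" (Lam "x" (LamU
    (Pair (ECons (App (V "e") (Fst (V "x"))) ENil) (Fst (V "x")))))).

Definition AuthentikitP : expr :=
  Pair retP (Pair bindP (Pack (tuple8 evi_authP evi_pairP evi_sumP evi_stringP
                                      evi_intP evi_muP authP unauthP))).

Definition runP : expr := Lam "c" (App (V "c") EUnit).

(*   auth a = string,  m a = proof -> 1 + proof × a,                   *)
(*   evidence = (serializer, deserializer)                              *)

Definition retV : expr := TLamE (Lam "a" (Lam "p" (ESome (Pair (V "p") (V "a"))))).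

Definition bindV : expr :=
  TLamE (TLamE (Lam "c" (Lam "f" (Lam "p"
    (Case (App (V "c") (V "p"))
      (Lam "_" ENone)
      (Lam "r" (App2 (V "f") (Snd (V "r")) (Fst (V "r"))))))))).

Definition evi_authV : expr := TLamE (Pair (Lam "x" (V "x")) (Lam "s" (ESome (V "s")))).

Definition evi_pairV : expr :=
  TLamE (TLamE (Lam "ea" (Lam "eb" (Pair
    (Lam "x"
      (Cat (Cat (EStr "P") (App frameE (App (Fst (V "ea")) (Fst (V "x")))))
           (App frameE (App (Fst (V "eb")) (Snd (V "x"))))))
    (Lam "s"
      (If (HeadIs "P" (V "s"))
        (Case (App2 parseFrameE (V "s") (EInt 1))
          (Lam "_" ENone)
          (Lam "fa"
            (Case (App2 parseFrameE (V "s") (Snd (V "fa")))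
              (Lam "_" ENone)
              (Lam "fb"
                (If (EEq (Snd (V "fb")) (UnOp StrLenOp (V "s")))
                  (Case (App (Snd (V "ea")) (Fst (V "fa")))
                    (Lam "_" ENone)
                    (Lam "a"
                      (Case (App (Snd (V "eb")) (Fst (V "fb")))
                        (Lam "_" ENone)
                        (Lam "b" (ESome (Pair (V "a") (V "b")))))))
                  ENone)))))
        ENone)))))).

Definition evi_sumV : expr :=
  TLamE (TLamE (Lam "ea" (Lam "eb" (Pair
    (Lam "x"
      (Case (V "x")
        (Lam "y" (Cat (EStr "L") (App (Fst (V "ea")) (V "y"))))
        (Lam "y" (Cat (EStr "R") (App (Fst (V "eb")) (V "y"))))))
    (Lam "s"
      (If (HeadIs "L" (V "s"))
        (OptMap "y" (InjL (V "y")) (App (Snd (V "ea")) (Rest (V "s"))))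
        (If (HeadIs "R" (V "s"))
          (OptMap "y" (InjR (V "y")) (App (Snd (V "eb")) (Rest (V "s"))))
          ENone))))))).

Definition evi_stringV : expr :=
  Pair (Lam "x" (Cat (EStr "S") (V "x")))
       (Lam "s" (If (HeadIs "S" (V "s")) (ESome (Rest (V "s"))) ENone)).

Definition evi_intV : expr :=
  Pair (Lam "x" (Cat (EStr "I") (UnOp IntToStrOp (V "x"))))
       (Lam "s" (If (HeadIs "I" (V "s")) (UnOp StrToIntOp (Rest (V "s"))) ENone)).

Definition evi_muV : expr :=
  TLamE (Lam "e" (Pair
    (Lam "x" (App (Fst (V "e")) (Unfold (V "x"))))
    (Lam "s" (OptMap "y" (Fold (V "y")) (App (Snd (V "e")) (V "s")))))).

Definition authV : expr :=
  TLamE (Lam "e" (Lam "a" (Hash (App (Fst (V "e")) (V "a"))))).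

Definition unauthV : expr :=
  TLamE (Lam "e" (Lam "h" (Lam "p"
    (Case (Unfold (V "p"))
      (Lam "_" ENone)
      (Lam "c"
        (LetE "s" (Fst (V "c"))
          (If (EEq (Hash (V "s")) (V "h"))
            (Case (App (Snd (V "e")) (V "s"))
              (Lam "_" ENone)
              (Lam "a" (ESome (Pair (Snd (V "c")) (V "a")))))
            ENone))))))).

Definition AuthentikitV : expr :=
  Pair retV (Pair bindV (Pack (tuple8 evi_authV evi_pairV evi_sumV evi_stringV
                                      evi_intV evi_muV authV unauthV))).

Definition runV : expr :=
  Lam "c" (Lam "p"
    (Case (App (V "c") (V "p"))
      (Lam "_" ENone)
      (Lam "r" (ESome (Snd (V "r")))))).

(*   auth a = a,  m a = 1 -> a,  evidence carries no information (unit) *)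

Definition retI : expr := TLamE (Lam "a" (LamU (V "a"))).
Definition bindI : expr :=
  TLamE (TLamE (Lam "c" (Lam "f" (LamU
    (App2 (V "f") (App (V "c") EUnit) EUnit))))).
Definition evi_authI : expr := TLamE EUnit.
Definition evi_pairI : expr := TLamE (TLamE (Lam "ea" (Lam "eb" EUnit))).
Definition evi_sumI : expr := TLamE (TLamE (Lam "ea" (Lam "eb" EUnit))).
Definition evi_stringI : expr := EUnit.
Definition evi_intI : expr := EUnit.
Definition evi_muI : expr := TLamE (Lam "e" EUnit).
Definition authI : expr := TLamE (Lam "e" (Lam "a" (V "a"))).
Definition unauthI : expr := TLamE (Lam "e" (Lam "a" (LamU (V "a")))).

Definition AuthentikitI : expr :=
  Pair retI (Pair bindI (Pack (tuple8 evi_authI evi_pairI evi_sumI evi_stringI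
                                      evi_intI evi_muI authI unauthI))).

Definition runI : expr := Lam "c" (App (V "c") EUnit).

Definition prog_P (e : expr) : expr := App runP (App (TAppE (TAppE e)) AuthentikitP).
Definition prog_V (e : expr) (p : val) : expr :=
  App2 runV (App (TAppE (TAppE e)) AuthentikitV) (Val p).
Definition prog_I (e : expr) : expr := App runI (App (TAppE (TAppE e)) AuthentikitI).

(* Main.v *)
Require Import Defs.
From Stdlib Require Import List String Ascii ZArith Bool Lia FunctionalExtensionality.
Import ListNotations.
Open Scope string_scope.

(** The client is well typed, so it treats [auth], [m] and the evidence type as abstract.
    Hence the three runs proceed in lockstep, related by a syntactic relation: the client code
    is the same in all three, and abstract values occur as corresponding triples. Client
    evaluation preserves this relation (an instance of subject reduction, relying on the
    confluence of type conversion to exclude that the client inspects an abstract value).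
    A related triple of monadic computations is then run: if the prover emits the strings [ps],
    the verifier consumes [ps] from any proof [ps ++ rest] and produces a related value.
    This works because the serialization of a value does not depend on the evidence used, so
    that the string emitted by [unauth] hashes to the stored hash, and the deserializer of
    well-typed evidence inverts the serializer. Related values of primitive type are equal. *)

(** * Conversion of types *)

(** A semantic relation would need step-indexed worlds to cope with higher-order references,
    recursive types and impredicative quantification. A syntactic relation indexed by a store typing
    avoids this circularity: it is an ordinary inductive definition, and the simulation is an
    induction on the prover's evaluation. The price is that library code must be described at each
    stage: under its abstractions, with parameters supplied, and as a closure. One rule covers these
    stages for all operations whose body is a value; [auth] has its own rule because it hashes
    before it returns. The argument is one-sided. The prover's derivation is given and gets
    inverted; those of the verifier and the ideal implementation are constructed, so their
    termination is inherited from the prover. Big-step derivations suit both purposes and are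
    exchanged with reduction sequences only at the two ends. *)

Definition scons (u : ty) (s : nat -> ty) : nat -> ty :=
  fun n => match n with 0 => u | S n => s n end.

Lemma tren_tren r r' t : tren r (tren r' t) = tren (fun n => r (r' n)) t.
Proof.
  revert r r'; induction t; intros r r'; cbn; f_equal; auto; rewrite IHt;
    f_equal; extensionality n; destruct n; reflexivity.
Qed.

Lemma tsubst_tren s r t : tsubst s (tren r t) = tsubst (fun n => s (r n)) t.
Proof.
  revert s r; induction t; intros s r; cbn; f_equal; auto; rewrite IHt;
    f_equal; extensionality n; destruct n; reflexivity.
Qed.

Lemma tren_tsubst r s t : tren r (tsubst s t) = tsubst (fun n => tren r (s n)) t.
Proof.
  revert s r; induction t; intros s r; cbn; f_equal; auto; rewrite IHt;
    f_equal; extensionality n; destruct n; cbn; auto;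
    unfold tshift; rewrite !tren_tren; reflexivity.
Qed.

Lemma tsubst_tsubst s s' t :
  tsubst s (tsubst s' t) = tsubst (fun n => tsubst s (s' n)) t.
Proof.
  revert s s'; induction t; intros s s'; cbn; f_equal; auto; rewrite IHt;
    f_equal; extensionality n; destruct n; cbn; auto;
    unfold tshift; rewrite tsubst_tren, tren_tsubst; reflexivity.
Qed.

Lemma up_sub_TVar : up_sub TVar = TVar.
Proof. extensionality n; destruct n; reflexivity. Qed.

Lemma tsubst_TVar t : tsubst TVar t = t.
Proof. induction t; cbn; rewrite ?up_sub_TVar; congruence. Qed.

Lemma tren_tsubst_TVar r t : tren r t = tsubst (fun n => TVar (r n)) t.
Proof. rewrite <- (tsubst_TVar (tren r t)). apply tsubst_tren. Qed.

Lemma tsubst_tshift s t : tsubst (up_sub s) (tshift t) = tshift (tsubst s t).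
Proof. unfold tshift. rewrite tsubst_tren, tren_tsubst. reflexivity. Qed.

Lemma tsubst1_tshift u t : tsubst1 (tshift t) u = t.
Proof. unfold tsubst1, tshift. rewrite tsubst_tren. apply tsubst_TVar. Qed.

Lemma tsubst_tsubst1 s t u :
  tsubst s (tsubst1 t u) = tsubst1 (tsubst (up_sub s) t) (tsubst s u).
Proof.
  unfold tsubst1. rewrite !tsubst_tsubst. f_equal. extensionality n.
  destruct n; cbn; auto. unfold tshift. rewrite tsubst_tren. symmetry. apply tsubst_TVar.
Qed.

Lemma tren_tsubst1 r t u : tren r (tsubst1 t u) = tsubst1 (tren (up_ren r) t) (tren r u).
Proof.
  rewrite !tren_tsubst_TVar, tsubst_tsubst1. do 2 f_equal.
  extensionality n. destruct n; reflexivity.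
Qed.

Lemma tsubst_tapps s t args :
  tsubst s (tapps t args) = tapps (tsubst s t) (map (tsubst s) args).
Proof. revert t; induction args; intros t; cbn; [auto|apply IHargs]. Qed.

(** * Parallel reduction and the Church-Rosser property *)

Inductive par : ty -> ty -> Prop :=
  | par_Var n : par (TVar n) (TVar n)
  | par_Unit : par TUnit TUnit
  | par_Bool : par TBool TBool
  | par_Int : par TInt TInt
  | par_String : par TString TString
  | par_Prod a a' b b' : par a a' -> par b b' -> par (TProd a b) (TProd a' b')
  | par_Sum a a' b b' : par a a' -> par b b' -> par (TSum a b) (TSum a' b')
  | par_Arr a a' b b' : par a a' -> par b b' -> par (TArr a b) (TArr a' b')
  | par_Ref a a' : par a a' -> par (TRef a) (TRef a')
  | par_Forall k a a' : par a a' -> par (TForall k a) (TForall k a')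
  | par_Exists k a a' : par a a' -> par (TExists k a) (TExists k a')
  | par_Mu k a a' : par a a' -> par (TMu k a) (TMu k a')
  | par_Lam k a a' : par a a' -> par (TLam k a) (TLam k a')
  | par_App a a' b b' : par a a' -> par b b' -> par (TApp a b) (TApp a' b')
  | par_beta k a a' b b' :
      par a a' -> par b b' -> par (TApp (TLam k a) b) (tsubst1 a' b').

Lemma par_refl t : par t t.
Proof. induction t; constructor; auto. Qed.

Lemma par_tren r t t' : par t t' -> par (tren r t) (tren r t').
Proof.
  intros Hp; revert r; induction Hp; intros r; cbn; try (constructor; auto; fail).
  rewrite tren_tsubst1. constructor; auto.
Qed.

Lemma par_tsubst t t' s s' :
  par t t' -> (forall n, par (s n) (s' n)) -> par (tsubst s t) (tsubst s' t').
Proof.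
  assert (Hup : forall s s', (forall n, par (s n) (s' n)) ->
                forall n, par (up_sub s n) (up_sub s' n)).
  { intros s0 s0' Hs [|n]; cbn; [constructor|apply par_tren, Hs]. }
  intros Hp; revert s s'; induction Hp; intros s s' Hs; cbn; try (constructor; auto; fail).
  - apply Hs.
  - rewrite tsubst_tsubst1. constructor; auto.
Qed.

Lemma par_tsubst1 t t' u u' : par t t' -> par u u' -> par (tsubst1 t u) (tsubst1 t' u').
Proof.
  intros Ht Hu. apply par_tsubst; auto. intros [|n]; [auto|constructor].
Qed.

(** Takahashi's complete development: all redexes present in the type are contracted at once. *)
Fixpoint dev (t : ty) : ty :=
  match t with
  | TVar _ | TUnit | TBool | TInt | TString => t
  | TProd a b => TProd (dev a) (dev b)
  | TSum a b => TSum (dev a) (dev b)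
  | TArr a b => TArr (dev a) (dev b)
  | TRef a => TRef (dev a)
  | TForall k a => TForall k (dev a)
  | TExists k a => TExists k (dev a)
  | TMu k a => TMu k (dev a)
  | TLam k a => TLam k (dev a)
  | TApp (TLam k a) b => tsubst1 (dev a) (dev b)
  | TApp a b => TApp (dev a) (dev b)
  end.

(** Triangle property: the target depends only on [t], so any two parallel reducts of [t] meet
    there. *)
Lemma par_dev t t' : par t t' -> par t' (dev t).
Proof.
  induction 1; cbn [dev]; try (constructor; auto; fail).
  - destruct a; try (constructor; auto; fail).
    (* A redex that was left uncontracted: its reduct is still a redex, and [par_beta] contracts it
       now. *)
    inversion H; subst. cbn [dev] in IHpar1. inversion IHpar1; subst.
    constructor; auto.
  - apply par_tsubst1; auto.
Qed.

Notation pars := (rtc par).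

Lemma rtc_trans A (Q : A -> A -> Prop) x y z : rtc Q x y -> rtc Q y z -> rtc Q x z.
Proof. induction 1; intros; auto. econstructor; eauto. Qed.

(** At each step of the long reduction, the side branch moves on to the complete development of the
    current type. *)
Lemma pars_strip t u w : par t u -> pars t w -> exists z, pars u z /\ par w z.
Proof.
  intros Hu Hw; revert u Hu; induction Hw as [t|t t' w Ht _ IH]; intros u Hu.
  - exists u. split; [constructor|auto].
  - destruct (IH (dev t) (par_dev _ _ Ht)) as (z & Hz & Hwz).
    exists z. split; auto. econstructor; [apply par_dev; eauto|auto].
Qed.

Lemma pars_confluent t u w : pars t u -> pars t w -> exists z, pars u z /\ pars w z.
Proof.
  intros Hu; revert w; induction Hu as [t|t t' u Ht _ IH]; intros w Hw.
  - exists w. split; [auto|constructor].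
  - destruct (pars_strip _ _ _ Ht Hw) as (z & Hz & Hwz).
    destruct (IH z Hz) as (y & Hy & Hzy).
    exists y. split; auto. econstructor; eauto.
Qed.

Lemma pars_cong (f : ty -> ty) t t' :
  (forall t t', par t t' -> par (f t) (f t')) -> pars t t' -> pars (f t) (f t').
Proof. intros Hf; induction 1; econstructor; eauto. Qed.

Lemma pars_cong2 (f : ty -> ty -> ty) t t' u u' :
  (forall t t' u u', par t t' -> par u u' -> par (f t u) (f t' u')) ->
  pars t t' -> pars u u' -> pars (f t u) (f t' u').
Proof.
  intros Hf Ht Hu. apply rtc_trans with (f t' u).
  - apply (pars_cong (fun x => f x u)); auto using par_refl.
  - apply (pars_cong (f t')); auto using par_refl.
Qed.

Theorem teq_joinable t u : teq t u -> exists w, pars t w /\ pars u w.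
Proof.
  induction 1;
  repeat match goal with H : exists _, _ /\ _ |- _ => destruct H as (? & ? & ?) end;
  try (eexists; split;
    (apply pars_cong2 || apply pars_cong); eauto using par; fail).
  - exists t. split; constructor.
  - eauto.
  - match goal with H1 : pars u ?x, H2 : pars u ?y |- _ =>
      destruct (pars_confluent _ _ _ H1 H2) as (z & ? & ?) end.
    exists z. split; eapply rtc_trans; eauto.
  - exists (tsubst1 t u). split; [|constructor].
    econstructor; [|constructor]. constructor; apply par_refl.
Qed.

Lemma teq_tsubst s t t' : teq t t' -> teq (tsubst s t) (tsubst s t').
Proof.
  intros He; revert s; induction He; intros s; cbn; try (constructor; auto; fail).
  - eapply teq_trans; eauto.
  - rewrite tsubst_tsubst1. apply teq_beta.
Qed.

Lemma teq_tsubst_ext t s s' :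
  (forall n, teq (s n) (s' n)) -> teq (tsubst s t) (tsubst s' t).
Proof.
  assert (Hup : forall s s', (forall n, teq (s n) (s' n)) ->
                forall n, teq (up_sub s n) (up_sub s' n)).
  { intros s0 s0' Hs [|n]; cbn; [constructor|].
    unfold tshift. rewrite !tren_tsubst_TVar. apply teq_tsubst, Hs. }
  revert s s'; induction t; intros s s' Hs; cbn; try (constructor; auto; fail).
  apply Hs.
Qed.

Lemma teq_tsubst1 t t' u u' : teq t t' -> teq u u' -> teq (tsubst1 t u) (tsubst1 t' u').
Proof.
  intros Ht Hu. eapply teq_trans; [apply teq_tsubst, Ht|].
  apply teq_tsubst_ext. intros [|n]; [auto|constructor].
Qed.

(** * Inversion of conversion between rigid types *)

(* Types whose spine is not headed by an abstraction: conversion acts on their components only. *)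
Fixpoint rigid (t : ty) : Prop :=
  match t with TApp a _ => rigid a | TLam _ _ => False | _ => True end.

(** Heads are compared along the application spine and components only up to conversion, so that
    refuting or inverting a conversion becomes a computation. *)
Fixpoint sim (t u : ty) : Prop :=
  match t, u with
  | TVar n, TVar m => n = m
  | TUnit, TUnit | TBool, TBool | TInt, TInt | TString, TString => True
  | TProd a b, TProd a' b' | TSum a b, TSum a' b' | TArr a b, TArr a' b' =>
      teq a a' /\ teq b b'
  | TRef a, TRef a' => teq a a'
  | TForall k a, TForall k' a' | TExists k a, TExists k' a' | TMu k a, TMu k' a' =>
      k = k' /\ teq a a'
  | TApp a b, TApp a' b' => sim a a' /\ teq b b'
  | _, _ => False
  end.

Lemma par_teq t u : par t u -> teq t u.
Proof.
  induction 1; try (constructor; auto; fail).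
  eapply teq_trans; [apply teq_beta|apply teq_tsubst1; auto].
Qed.

Lemma sim_refl t : rigid t -> sim t t.
Proof. induction t; cbn; auto using teq_refl; try tauto; split; auto using teq_refl. Qed.

Lemma sim_sym t u : sim t u -> sim u t.
Proof.
  revert u; induction t; destruct u; cbn; auto; intuition auto using teq_sym.
Qed.

Lemma sim_trans t u w : sim t u -> sim u w -> sim t w.
Proof.
  revert u w; induction t; destruct u; cbn; try tauto; destruct w; cbn; try tauto;
    intuition (try congruence; eauto using teq_trans).
Qed.

(** A rigid spine contains no head redex, hence reduction acts inside the components and cannot
    create an abstraction at the head. *)
Lemma par_sim t u : par t u -> rigid t -> rigid u /\ sim t u.
Proof. induction 1; cbn; intuition auto using par_teq. Qed.

Lemma pars_sim t u : pars t u -> rigid t -> sim t u.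
Proof.
  induction 1 as [t|t t' u Ht _ IH]; intros Hr; [apply sim_refl, Hr|].
  destruct (par_sim _ _ Ht Hr). eauto using sim_trans.
Qed.

(** Both types reduce to a common one, and reduction keeps their head structure. This gives
    injectivity and disjointness of type constructors. *)
Theorem teq_sim t u : teq t u -> rigid t -> rigid u -> sim t u.
Proof.
  intros He Ht Hu. destruct (teq_joinable _ _ He) as (w & Htw & Huw).
  eauto using sim_trans, sim_sym, pars_sim.
Qed.

Lemma rigid_tapps t args : rigid t -> rigid (tapps t args).
Proof. revert t; induction args; cbn; auto. Qed.

(** Separates [tapps (TMu k F) args] from other types when [args] is a variable and [sim] cannot
    compute. *)
Fixpoint mu_headed (t : ty) : Prop :=
  match t with TMu _ _ => True | TApp a _ => mu_headed a | _ => False end.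

Lemma sim_mu_headed t u : sim t u -> mu_headed t -> mu_headed u.
Proof. revert u; induction t; destruct u; cbn; intuition eauto. Qed.

Lemma mu_headed_tapps t args : mu_headed t -> mu_headed (tapps t args).
Proof. revert t; induction args; cbn; auto. Qed.

Lemma teq_tapps t t' args args' :
  teq t t' -> Forall2 teq args args' -> teq (tapps t args) (tapps t' args').
Proof. intros Ht Ha; revert t t' Ht; induction Ha; intros; cbn; auto using teq_App. Qed.

Lemma tapps_snoc t args a : tapps t (args ++ [a]) = TApp (tapps t args) a.
Proof. revert t; induction args; cbn; auto. Qed.

(** The outermost application carries the last argument, hence the induction from the end of the
    list. *)
Lemma sim_tapps_mu k F args k' F' args' :
  sim (tapps (TMu k F) args) (tapps (TMu k' F') args') ->
  k = k' /\ teq F F' /\ Forall2 teq args args'.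
Proof.
  revert args'; induction args as [|a args IH] using rev_ind;
    intros args'; destruct args' as [|a' args' _] using rev_ind;
    rewrite ?tapps_snoc; cbn; try tauto.
  - intuition auto.
  - intros (Hs & Ha). destruct (IH _ Hs) as (? & ? & ?).
    repeat split; auto. apply Forall2_app; auto.
Qed.

(** Needed to unfold a value that was folded at a different but convertible recursive type. *)
Lemma teq_unfold k F args k' F' args' :
  teq (tapps (TMu k F) args) (tapps (TMu k' F') args') ->
  teq (tapps (tsubst1 F (TMu k F)) args) (tapps (tsubst1 F' (TMu k' F')) args').
Proof.
  intros He. apply teq_sim in He; try (apply rigid_tapps; exact I).
  apply sim_tapps_mu in He as (-> & ? & ?).
  apply teq_tapps; auto. apply teq_tsubst1; auto using teq_Mu.
Qed.

(** * Big-step evaluation *)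

Section BigStep.
Context {I : Type} (hashf : I -> string -> string).

(* The index is the induction measure for running a monadic computation, whose [bind]s run
   computations found deep inside the derivation. *)
Inductive big : nat -> expr -> state I -> val -> state I -> Prop :=
  | big_Val v σ : big 0 (Val v) σ v σ
  | big_Rec f x e σ : big 0 (Rec f x e) σ (RecV f x e) σ
  | big_TLamE e σ : big 0 (TLamE e) σ (TLamV e) σ
  | big_App n1 n2 n3 e1 e2 f x e v2 v σ σ1 σ2 σ3 :
      big n1 e1 σ (RecV f x e) σ1 -> big n2 e2 σ1 v2 σ2 ->
      big n3 (subst' x v2 (subst' f (RecV f x e) e)) σ2 v σ3 ->
      big (S (n1 + n2 + n3)) (App e1 e2) σ v σ3
  | big_UnOp n1 op e v w σ σ1 :
      big n1 e σ v σ1 -> un_op_eval op v = Some w -> big (S n1) (UnOp op e) σ w σ1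
  | big_BinOp n1 n2 op e1 e2 v1 v2 w σ σ1 σ2 :
      big n1 e1 σ v1 σ1 -> big n2 e2 σ1 v2 σ2 -> bin_op_eval op v1 v2 = Some w ->
      big (S (n1 + n2)) (BinOp op e1 e2) σ w σ2
  | big_Substr n1 n2 n3 e1 e2 e3 s a b σ σ1 σ2 σ3 :
      big n1 e1 σ (LitV (LString s)) σ1 -> big n2 e2 σ1 (LitV (LInt a)) σ2 ->
      big n3 e3 σ2 (LitV (LInt b)) σ3 ->
      big (S (n1 + n2 + n3)) (Substr e1 e2 e3) σ
        (LitV (LString (String.substring (Z.to_nat a) (Z.to_nat b) s))) σ3
  | big_If n1 n2 e0 e1 e2 (b : bool) v σ σ1 σ2 :
      big n1 e0 σ (LitV (LBool b)) σ1 -> big n2 (if b then e1 else e2) σ1 v σ2 ->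
      big (S (n1 + n2)) (If e0 e1 e2) σ v σ2
  | big_Pair n1 n2 e1 e2 v1 v2 σ σ1 σ2 :
      big n1 e1 σ v1 σ1 -> big n2 e2 σ1 v2 σ2 ->
      big (S (n1 + n2)) (Pair e1 e2) σ (PairV v1 v2) σ2
  | big_Fst n1 e v1 v2 σ σ1 : big n1 e σ (PairV v1 v2) σ1 -> big (S n1) (Fst e) σ v1 σ1
  | big_Snd n1 e v1 v2 σ σ1 : big n1 e σ (PairV v1 v2) σ1 -> big (S n1) (Snd e) σ v2 σ1
  | big_InjL n1 e v σ σ1 : big n1 e σ v σ1 -> big (S n1) (InjL e) σ (InjLV v) σ1
  | big_InjR n1 e v σ σ1 : big n1 e σ v σ1 -> big (S n1) (InjR e) σ (InjRV v) σ1
  | big_CaseL n1 n2 e0 e1 e2 w v σ σ1 σ2 :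
      big n1 e0 σ (InjLV w) σ1 -> big n2 (App e1 (Val w)) σ1 v σ2 ->
      big (S (n1 + n2)) (Case e0 e1 e2) σ v σ2
  | big_CaseR n1 n2 e0 e1 e2 w v σ σ1 σ2 :
      big n1 e0 σ (InjRV w) σ1 -> big n2 (App e2 (Val w)) σ1 v σ2 ->
      big (S (n1 + n2)) (Case e0 e1 e2) σ v σ2
  | big_Fold n1 e v σ σ1 : big n1 e σ v σ1 -> big (S n1) (Fold e) σ (FoldV v) σ1
  | big_Unfold n1 e v σ σ1 : big n1 e σ (FoldV v) σ1 -> big (S n1) (Unfold e) σ v σ1
  | big_TAppE n1 n2 e e' v σ σ1 σ2 :
      big n1 e σ (TLamV e') σ1 -> big n2 e' σ1 v σ2 -> big (S (n1 + n2)) (TAppE e) σ v σ2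
  | big_Pack n1 e v σ σ1 : big n1 e σ v σ1 -> big (S n1) (Pack e) σ (PackV v) σ1
  | big_Unpack n1 n2 e1 x e2 w v σ σ1 σ2 :
      big n1 e1 σ (PackV w) σ1 -> big n2 (subst' x w e2) σ1 v σ2 ->
      big (S (n1 + n2)) (Unpack e1 x e2) σ v σ2
  | big_Alloc n1 e v l σ m h i :
      big n1 e σ v (mkState m h i) -> m l = None ->
      big (S n1) (Alloc e) σ (LitV (LLoc l)) (mkState (heap_upd m l v) h i)
  | big_Deref n1 e v l σ m h i :
      big n1 e σ (LitV (LLoc l)) (mkState m h i) -> m l = Some v ->
      big (S n1) (Deref e) σ v (mkState m h i)
  | big_Store n1 n2 e1 e2 l v w σ σ1 m h i :
      big n1 e1 σ (LitV (LLoc l)) σ1 -> big n2 e2 σ1 v (mkState m h i) -> m l = Some w ->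
      big (S (n1 + n2)) (Store e1 e2) σ unitV (mkState (heap_upd m l v) h i)
  | big_Hash n1 e s σ m h i :
      big n1 e σ (LitV (LString s)) (mkState m h i) ->
      big (S n1) (Hash e) σ (LitV (LString (hashf i s))) (mkState m (s :: h) i).

Definition evals (e : expr) (σ : state I) (v : val) (σ' : state I) : Prop :=
  exists n, big n e σ v σ'.

Ltac inv_val :=
  repeat match goal with
  | H : big _ (Val _) _ _ _ |- _ => inversion H; clear H; subst
  end.

(** Evaluation is pulled back along a step; a run ending in a value thus yields a derivation,
    working backwards from its end. *)
Lemma head_step_big e1 σ1 e2 σ2 :
  head_step hashf e1 σ1 e2 σ2 -> forall v σ, evals e2 σ2 v σ -> evals e1 σ1 v σ.
Proof.
  intros Hs v σ (n & Hb). destruct Hs; inv_val;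
    eexists; solve [econstructor; eauto using big | eapply big_CaseR; eauto using big].
Qed.

Lemma fill_item_big K e1 σ1 e2 σ2 :
  (forall v σ, evals e2 σ2 v σ -> evals e1 σ1 v σ) ->
  forall v σ, evals (fill_item K e2) σ2 v σ -> evals (fill_item K e1) σ1 v σ.
Proof.
  intros He v σ (n & Hb).
  assert (Hbig : forall n v σ, big n e2 σ2 v σ -> evals e1 σ1 v σ)
    by (intros; apply He; eexists; eauto).
  destruct K; cbn in *; inversion Hb; clear Hb; subst; inv_val;
    match goal with H : big _ e2 _ _ _ |- _ => destruct (Hbig _ _ _ H) end;
    eexists; solve [econstructor; eauto using big | eapply big_CaseR; eauto using big].
Qed.

Lemma step_big c c' : step hashf c c' ->
  forall v σ, evals (fst c') (snd c') v σ -> evals (fst c) (snd c) v σ.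
Proof.
  (* The last frame of [K] is the outermost one. *)
  intros [K e1 e2 σ1 σ2 Hs]; cbn. induction K as [|k K IH] using rev_ind; cbn.
  - eauto using head_step_big.
  - unfold fill in *. rewrite !fold_left_app. cbn. apply fill_item_big, IH.
Qed.

Lemma rtc_step_big c c' : rtc (step hashf) c c' ->
  forall v, fst c' = Val v -> evals (fst c) (snd c) v (snd c').
Proof.
  induction 1 as [c|c c1 c' Hs _ IH]; intros v Hv.
  - rewrite Hv. exists 0. constructor.
  - eapply step_big; eauto.
Qed.

Lemma rtc_fill_item K c c' : rtc (step hashf) c c' ->
  rtc (step hashf) (fill_item K (fst c), snd c) (fill_item K (fst c'), snd c').
Proof.
  induction 1 as [c|c c1 c' Hs _ IH]; [constructor|].
  econstructor; [|apply IH].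
  destruct Hs as [K' e1 e2 σ1 σ2 Hs]; cbn.
  generalize (step_ctx hashf (K' ++ [K]) _ _ _ _ Hs).
  unfold fill. rewrite !fold_left_app. auto.
Qed.

Lemma rtc_fill_head K e σ v σ1 e' σ2 c :
  rtc (step hashf) (e, σ) (Val v, σ1) ->
  head_step hashf (fill_item K (Val v)) σ1 e' σ2 ->
  rtc (step hashf) (e', σ2) c ->
  rtc (step hashf) (fill_item K e, σ) c.
Proof.
  intros H1 H2 H3. eapply rtc_trans; [apply (rtc_fill_item K _ _ H1)|].
  econstructor; [apply (step_ctx hashf [] _ _ _ _ H2)|exact H3].
Qed.

Lemma rtc_head e σ e' σ' c :
  head_step hashf e σ e' σ' -> rtc (step hashf) (e', σ') c -> rtc (step hashf) (e, σ) c.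
Proof. intros H1 H2. econstructor; [apply (step_ctx hashf [] _ _ _ _ H1)|exact H2]. Qed.

Lemma big_rtc n e σ v σ' : big n e σ v σ' -> rtc (step hashf) (e, σ) (Val v, σ').
Proof.
  induction 1;
    try (eapply rtc_head; [constructor|apply rtc_refl]; fail).
  - constructor.
  - eapply rtc_trans; [apply (rtc_fill_item (AppLCtx e2) _ _ IHbig1)|cbn].
    eapply (rtc_fill_head (AppRCtx _)); [eassumption|constructor|eassumption].
  - eapply (rtc_fill_head (UnOpCtx op)); [eassumption|constructor; eassumption|constructor].
  - eapply rtc_trans; [apply (rtc_fill_item (BinOpLCtx op e2) _ _ IHbig1)|cbn].
    eapply (rtc_fill_head (BinOpRCtx _ _)); [eassumption|constructor; eassumption|constructor].
  - eapply rtc_trans; [apply (rtc_fill_item (Substr1Ctx e2 e3) _ _ IHbig1)|cbn].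
    eapply rtc_trans; [apply (rtc_fill_item (Substr2Ctx _ e3) _ _ IHbig2)|cbn].
    eapply (rtc_fill_head (Substr3Ctx _ _)); [eassumption|constructor; eassumption|constructor].
  - eapply (rtc_fill_head (IfCtx e1 e2)); [eassumption| |eassumption].
    destruct b; constructor.
  - eapply rtc_trans; [apply (rtc_fill_item (PairLCtx e2) _ _ IHbig1)|cbn].
    eapply (rtc_fill_head (PairRCtx _)); [eassumption|constructor|constructor].
  - eapply (rtc_fill_head FstCtx); [eassumption|constructor|constructor].
  - eapply (rtc_fill_head SndCtx); [eassumption|constructor|constructor].
  - eapply (rtc_fill_head InjLCtx); [eassumption|constructor|constructor].
  - eapply (rtc_fill_head InjRCtx); [eassumption|constructor|constructor].
  - eapply (rtc_fill_head (CaseCtx e1 e2)); [eassumption|constructor|eassumption].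
  - eapply (rtc_fill_head (CaseCtx e1 e2)); [eassumption|constructor|eassumption].
  - eapply (rtc_fill_head FoldCtx); [eassumption|constructor|constructor].
  - eapply (rtc_fill_head UnfoldCtx); [eassumption|constructor|constructor].
  - eapply (rtc_fill_head TAppCtx); [eassumption|constructor|eassumption].
  - eapply (rtc_fill_head PackCtx); [eassumption|constructor|constructor].
  - eapply (rtc_fill_head (UnpackCtx x e2)); [eassumption|constructor|eassumption].
  - eapply (rtc_fill_head AllocCtx); [eassumption|apply AllocS; eassumption|constructor].
  - eapply (rtc_fill_head DerefCtx); [eassumption|apply DerefS; eassumption|constructor].
  - eapply rtc_trans; [apply (rtc_fill_item (StoreLCtx e2) _ _ IHbig1)|cbn].
    eapply (rtc_fill_head (StoreRCtx _)); [eassumption|eapply StoreS; eassumption|constructor].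
  - eapply (rtc_fill_head HashCtx); [eassumption|apply HashS|constructor].
Qed.

End BigStep.

(** * The simulation relation *)

(* The abstract constructors [auth], [m] and [evi] are instantiated by base types: the applications
   below are ill-kinded, hence stuck, closed, and convertible only to themselves. *)
Definition tauth (t : ty) : ty := TApp TUnit t.
Definition tm (t : ty) : ty := TApp TBool t.
Definition tevi (t : ty) : ty := TApp TInt t.

Inductive impl := Prover | Verifier | Ideal.

(* Unlike the other library functions, [unauth] names its second parameter differently in the three
   implementations; its partial applications [OUnauth1] are therefore related as a whole. *)
Inductive op := ORet | OBind | OUnauth1 | OUnauth2 | OAuth | OPair | OSum | OString | OInt | OMu.

Definition op_src (j : impl) (o : op) : expr :=
  match o with
  | ORet => match j with Prover => retP | Verifier => retV | Ideal => retI end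
  | OBind => match j with Prover => bindP | Verifier => bindV | Ideal => bindI end
  | OUnauth1 | OUnauth2 =>
      match j with Prover => unauthP | Verifier => unauthV | Ideal => unauthI end
  | OAuth => match j with Prover => evi_authP | Verifier => evi_authV | Ideal => evi_authI end
  | OPair => match j with Prover => evi_pairP | Verifier => evi_pairV | Ideal => evi_pairI end
  | OSum => match j with Prover => evi_sumP | Verifier => evi_sumV | Ideal => evi_sumI end
  | OString =>
      match j with Prover => evi_stringP | Verifier => evi_stringV | Ideal => evi_stringI end
  | OInt => match j with Prover => evi_intP | Verifier => evi_intV | Ideal => evi_intI end
  | OMu => match j with Prover => evi_muP | Verifier => evi_muV | Ideal => evi_muI end
  end.

(** Counts the binders, type abstractions included, that are consumed before the body is reached.
    What remains is a closure, a pair of closures or unit, so it evaluates without effect. [auth] is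
    absent from the list because its body hashes. *)
Definition op_arity (o : op) : nat :=
  match o with
  | ORet => 2 | OBind => 4 | OUnauth1 => 2 | OUnauth2 => 3 | OAuth => 1
  | OPair => 4 | OSum => 4 | OString => 0 | OInt => 0 | OMu => 2
  end.

Fixpoint strip (n : nat) (e : expr) : expr :=
  match n, e with
  | S n, TLamE e | S n, Rec _ _ e => strip n e
  | _, _ => e
  end.

(* Operations with fewer than two arguments get dummy arguments, named by the empty string. *)
Definition op_var1 (o : op) : string :=
  match o with
  | ORet => "a" | OBind => "c" | OPair | OSum => "ea"
  | OMu | OUnauth1 | OUnauth2 => "e" | _ => ""
  end.

Definition op_var2 (j : impl) (o : op) : string :=
  match o with
  | OBind => "f" | OPair | OSum => "eb"
  | OUnauth2 => match j with Prover => "x" | Verifier => "h" | Ideal => "a" end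
  | _ => ""
  end.

(** A variable argument leaves the body open in that parameter. Library code before and after
    parameter passing thus has the same description. *)
Definition plug (x : string) (a e : expr) : expr :=
  match a with Val v => subst x v e | _ => e end.

Definition op_expr (j : impl) (o : op) (a b : expr) : expr :=
  plug (op_var2 j o) b (plug (op_var1 o) a (strip (op_arity o) (op_src j o))).

(** The default [unitV] is a placeholder: the function is meant for values, abstractions and pairs
    of these. *)
Fixpoint to_val (e : expr) : val :=
  match e with
  | Val v => v
  | Rec f x e => RecV f x e
  | Pair a b => PairV (to_val a) (to_val b)
  | _ => unitV
  end.

Definition op_val (j : impl) (o : op) (v w : val) : val := to_val (op_expr j o (Val v) (Val w)).

(** The types are those of the two arguments and of the result; a dummy argument has type
    [TUnit]. *)
Inductive op_typed : op -> ty -> ty -> ty -> Prop :=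
  | op_ret t : op_typed ORet t TUnit (tm t)
  | op_bind t u : op_typed OBind (tm t) (TArr t (tm u)) (tm u)
  | op_unauth1 t : op_typed OUnauth1 (tevi t) TUnit (TArr (tauth t) (tm t))
  | op_unauth2 t : op_typed OUnauth2 (tevi t) (tauth t) (tm t)
  | op_auth t : op_typed OAuth TUnit TUnit (tevi (tauth t))
  | op_pair t u : op_typed OPair (tevi t) (tevi u) (tevi (TProd t u))
  | op_sum t u : op_typed OSum (tevi t) (tevi u) (tevi (TSum t u))
  | op_string : op_typed OString TUnit TUnit (tevi TString)
  | op_int : op_typed OInt TUnit TUnit (tevi TInt)
  | op_mu f :
      op_typed OMu (tevi (TApp f (TMu KStar (TApp (tshift f) (TVar 0))))) TUnit
        (tevi (TMu KStar (TApp (tshift f) (TVar 0)))).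

Inductive atom (x : string) : expr -> expr -> expr -> Prop :=
  | atom_Var : atom x (Var x) (Var x) (Var x)
  | atom_Val v1 v2 v3 : atom x (Val v1) (Val v2) (Val v3).

Definition frame (s : string) : string :=
  int_to_string (Z.of_nat (String.length s)) ++ ":" ++ s.

(* [ser a a' s]: [s] is the serialization of a value represented by [a] in the prover
   and by [a'] in the verifier. *)
Inductive ser : val -> val -> string -> Prop :=
  | ser_string s : ser (LitV (LString s)) (LitV (LString s)) ("S" ++ s)
  | ser_int n : ser (LitV (LInt n)) (LitV (LInt n)) ("I" ++ int_to_string n)
  | ser_auth a h : ser (PairV a (LitV (LString h))) (LitV (LString h)) h
  | ser_pair a b a' b' s t :
      ser a a' s -> ser b b' t ->
      ser (PairV a b) (PairV a' b') ("P" ++ frame s ++ frame t)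
  | ser_inl a a' s : ser a a' s -> ser (InjLV a) (InjLV a') ("L" ++ s)
  | ser_inr a a' s : ser a a' s -> ser (InjRV a) (InjRV a') ("R" ++ s)
  | ser_fold a a' s : ser a a' s -> ser (FoldV a) (FoldV a') s.

(** Either representation alone is ambiguous: a prover pair may be a product or an authenticated
    value, a verifier string may be plain or a hash. Together they determine the rule, hence the
    string, without reference to a type. *)
Lemma ser_fun a a' s s' : ser a a' s -> ser a a' s' -> s = s'.
Proof.
  intros Hs; revert s'; induction Hs; intros s' Hs'; inversion Hs'; subst; auto;
    repeat f_equal; auto.
Qed.

(** Environments are functions, so that shadowing and exchange of bindings are equations by
    extensionality. Store typings use the same type. *)
Definition env (A : Type) : Type := A -> option ty.

Definition emap {A} (f : ty -> ty) (G : env A) : env A := fun x => option_map f (G x).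

Definition nil_env {A} : env A := fun _ => None.

Definition upd (b : binder) (t : ty) (G : env string) : env string :=
  match b with
  | BAnon => G
  | BNamed y => fun x => if string_dec x y then Some t else G x
  end.

Inductive lit_typed : lit -> ty -> Prop :=
  | lit_unit : lit_typed LUnit TUnit
  | lit_bool b : lit_typed (LBool b) TBool
  | lit_int n : lit_typed (LInt n) TInt
  | lit_string s : lit_typed (LString s) TString.

Section Relation.
Context (H : string -> string).

(* Prover, verifier and ideal expressions of a common type, in a store typing and a variable
   environment. Kinding is dropped: only the confluence of untyped conversion is needed. *)
Inductive rel : env loc -> env string -> expr -> expr -> expr -> ty -> Prop :=
  | rel_conv S G e1 e2 e3 t t' : rel S G e1 e2 e3 t -> teq t t' -> rel S G e1 e2 e3 t'
  | rel_Val S G v1 v2 v3 t : vrel S v1 v2 v3 t -> rel S G (Val v1) (Val v2) (Val v3) t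
  | rel_Op S G o a1 a2 a3 b1 b2 b3 t u r :
      o <> OUnauth2 -> op_typed o t u r ->
      atom (op_var1 o) a1 a2 a3 -> atom (op_var2 Prover o) b1 b2 b3 ->
      rel S G a1 a2 a3 t -> rel S G b1 b2 b3 u ->
      rel S G (op_expr Prover o a1 b1) (op_expr Verifier o a2 b2) (op_expr Ideal o a3 b3) r
  | rel_Auth S G e1 e2 e3 a1 a2 a3 t :
      atom "e" e1 e2 e3 -> atom "a" a1 a2 a3 ->
      rel S G e1 e2 e3 (tevi t) -> rel S G a1 a2 a3 t ->
      rel S G (Pair a1 (Hash (App e1 a1))) (Hash (App (Fst e2) a2)) a3 (tauth t)
  | rel_Var S G x t : G x = Some t -> rel S G (Var x) (Var x) (Var x) t
  | rel_Rec S G f x e1 e2 e3 t u :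
      rel S (upd f (TArr t u) (upd x t G)) e1 e2 e3 u ->
      rel S G (Rec f x e1) (Rec f x e2) (Rec f x e3) (TArr t u)
  | rel_App S G e1 e2 e3 a1 a2 a3 t u :
      rel S G e1 e2 e3 (TArr t u) -> rel S G a1 a2 a3 t ->
      rel S G (App e1 a1) (App e2 a2) (App e3 a3) u
  | rel_UnOp S G o e1 e2 e3 t u :
      un_op_typed o t u -> rel S G e1 e2 e3 t -> rel S G (UnOp o e1) (UnOp o e2) (UnOp o e3) u
  | rel_BinOp S G o e1 e2 e3 a1 a2 a3 t u r :
      bin_op_typed o t u r -> rel S G e1 e2 e3 t -> rel S G a1 a2 a3 u ->
      rel S G (BinOp o e1 a1) (BinOp o e2 a2) (BinOp o e3 a3) r
  | rel_Substr S G e1 e2 e3 a1 a2 a3 b1 b2 b3 :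
      rel S G e1 e2 e3 TString -> rel S G a1 a2 a3 TInt -> rel S G b1 b2 b3 TInt ->
      rel S G (Substr e1 a1 b1) (Substr e2 a2 b2) (Substr e3 a3 b3) TString
  | rel_If S G e1 e2 e3 a1 a2 a3 b1 b2 b3 t :
      rel S G e1 e2 e3 TBool -> rel S G a1 a2 a3 t -> rel S G b1 b2 b3 t ->
      rel S G (If e1 a1 b1) (If e2 a2 b2) (If e3 a3 b3) t
  | rel_Pair S G e1 e2 e3 a1 a2 a3 t u :
      rel S G e1 e2 e3 t -> rel S G a1 a2 a3 u ->
      rel S G (Pair e1 a1) (Pair e2 a2) (Pair e3 a3) (TProd t u)
  | rel_Fst S G e1 e2 e3 t u : rel S G e1 e2 e3 (TProd t u) -> rel S G (Fst e1) (Fst e2) (Fst e3) t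
  | rel_Snd S G e1 e2 e3 t u : rel S G e1 e2 e3 (TProd t u) -> rel S G (Snd e1) (Snd e2) (Snd e3) u
  | rel_InjL S G e1 e2 e3 t u :
      rel S G e1 e2 e3 t -> rel S G (InjL e1) (InjL e2) (InjL e3) (TSum t u)
  | rel_InjR S G e1 e2 e3 t u :
      rel S G e1 e2 e3 u -> rel S G (InjR e1) (InjR e2) (InjR e3) (TSum t u)
  | rel_Case S G e1 e2 e3 a1 a2 a3 b1 b2 b3 t u r :
      rel S G e1 e2 e3 (TSum t u) -> rel S G a1 a2 a3 (TArr t r) ->
      rel S G b1 b2 b3 (TArr u r) ->
      rel S G (Case e1 a1 b1) (Case e2 a2 b2) (Case e3 a3 b3) r
  | rel_Fold S G e1 e2 e3 k F args :
      rel S G e1 e2 e3 (tapps (tsubst1 F (TMu k F)) args) ->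
      rel S G (Fold e1) (Fold e2) (Fold e3) (tapps (TMu k F) args)
  | rel_Unfold S G e1 e2 e3 k F args :
      rel S G e1 e2 e3 (tapps (TMu k F) args) ->
      rel S G (Unfold e1) (Unfold e2) (Unfold e3) (tapps (tsubst1 F (TMu k F)) args)
  | rel_TLam S G e1 e2 e3 k t :
      rel (emap tshift S) (emap tshift G) e1 e2 e3 t ->
      rel S G (TLamE e1) (TLamE e2) (TLamE e3) (TForall k t)
  | rel_TApp S G e1 e2 e3 k t u :
      rel S G e1 e2 e3 (TForall k t) ->
      rel S G (TAppE e1) (TAppE e2) (TAppE e3) (tsubst1 t u)
  | rel_Pack S G e1 e2 e3 k t u :
      rel S G e1 e2 e3 (tsubst1 t u) ->
      rel S G (Pack e1) (Pack e2) (Pack e3) (TExists k t)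
  | rel_Unpack S G e1 e2 e3 x a1 a2 a3 k t r :
      rel S G e1 e2 e3 (TExists k t) ->
      rel (emap tshift S) (upd x t (emap tshift G)) a1 a2 a3 (tshift r) ->
      rel S G (Unpack e1 x a1) (Unpack e2 x a2) (Unpack e3 x a3) r
  | rel_Alloc S G e1 e2 e3 t :
      rel S G e1 e2 e3 t -> rel S G (Alloc e1) (Alloc e2) (Alloc e3) (TRef t)
  | rel_Deref S G e1 e2 e3 t :
      rel S G e1 e2 e3 (TRef t) -> rel S G (Deref e1) (Deref e2) (Deref e3) t
  | rel_Store S G e1 e2 e3 a1 a2 a3 t :
      rel S G e1 e2 e3 (TRef t) -> rel S G a1 a2 a3 t ->
      rel S G (Store e1 a1) (Store e2 a2) (Store e3 a3) TUnit
  | rel_Hash S G e1 e2 e3 :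
      rel S G e1 e2 e3 TString -> rel S G (Hash e1) (Hash e2) (Hash e3) TString
(* Components are related through [rel], which lets conversion act on their types. A location is the
   same in all three runs. In [vrel_Auth] the stored hash is that of the payload's serialization,
   the invariant behind the verifier's check. *)
with vrel : env loc -> val -> val -> val -> ty -> Prop :=
  | vrel_Lit S l t : lit_typed l t -> vrel S (LitV l) (LitV l) (LitV l) t
  | vrel_Loc S l t : S l = Some t -> vrel S (LitV (LLoc l)) (LitV (LLoc l)) (LitV (LLoc l)) (TRef t)
  | vrel_Rec S f x e1 e2 e3 t u :
      rel S (upd f (TArr t u) (upd x t nil_env)) e1 e2 e3 u ->
      vrel S (RecV f x e1) (RecV f x e2) (RecV f x e3) (TArr t u)
  | vrel_Pair S v1 v2 v3 w1 w2 w3 t u :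
      rel S nil_env (Val v1) (Val v2) (Val v3) t ->
      rel S nil_env (Val w1) (Val w2) (Val w3) u ->
      vrel S (PairV v1 w1) (PairV v2 w2) (PairV v3 w3) (TProd t u)
  | vrel_InjL S v1 v2 v3 t u :
      rel S nil_env (Val v1) (Val v2) (Val v3) t ->
      vrel S (InjLV v1) (InjLV v2) (InjLV v3) (TSum t u)
  | vrel_InjR S v1 v2 v3 t u :
      rel S nil_env (Val v1) (Val v2) (Val v3) u ->
      vrel S (InjRV v1) (InjRV v2) (InjRV v3) (TSum t u)
  | vrel_Fold S v1 v2 v3 k F args :
      rel S nil_env (Val v1) (Val v2) (Val v3) (tapps (tsubst1 F (TMu k F)) args) ->
      vrel S (FoldV v1) (FoldV v2) (FoldV v3) (tapps (TMu k F) args)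
  | vrel_TLam S e1 e2 e3 k t :
      rel (emap tshift S) nil_env e1 e2 e3 t ->
      vrel S (TLamV e1) (TLamV e2) (TLamV e3) (TForall k t)
  | vrel_Pack S v1 v2 v3 k t u :
      rel S nil_env (Val v1) (Val v2) (Val v3) (tsubst1 t u) ->
      vrel S (PackV v1) (PackV v2) (PackV v3) (TExists k t)
  | vrel_Op S o v1 v2 v3 w1 w2 w3 t u r :
      op_typed o t u r ->
      rel S nil_env (Val v1) (Val v2) (Val v3) t ->
      rel S nil_env (Val w1) (Val w2) (Val w3) u ->
      vrel S (op_val Prover o v1 w1) (op_val Verifier o v2 w2) (op_val Ideal o v3 w3) r
  | vrel_Auth S a1 a2 a3 s t :
      rel S nil_env (Val a1) (Val a2) (Val a3) t -> ser a1 a2 s ->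
      vrel S (PairV a1 (LitV (LString (H s)))) (LitV (LString (H s))) a3 (tauth t).

(* Reflexivity on client code, type substitution and store extension *)
Scheme rel_mut := Induction for rel Sort Prop
  with vrel_mut := Induction for vrel Sort Prop.
Combined Scheme rel_vrel_ind from rel_mut, vrel_mut.

(** The store typing is arbitrary because typed source terms contain no locations. *)
Lemma typed_rel S D G e t : typed D G e t -> rel S (lookup G) e e e t.
Proof.
  assert (Hupd : forall b t G, lookup (bind_env b t G) = upd b t (lookup G))
    by (intros []; reflexivity).
  assert (Hshift : forall G, lookup (shift_env G) = emap tshift (lookup G)).
  { intros G0. extensionality x. induction G0 as [|[y u] G0 IH]; [reflexivity|].
    unfold emap in *. cbn. destruct (string_dec x y); [reflexivity|exact IH]. }
  intros Ht; revert S; induction Ht; intros S; rewrite ?Hupd, ?Hshift in *;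
    try (econstructor; eauto; fail).
  all: repeat constructor; auto.
Qed.

Lemma emap_emap {A} f g (G : env A) : emap f (emap g G) = emap (fun t => f (g t)) G.
Proof. extensionality x. unfold emap. destruct (G x); auto. Qed.

Lemma emap_upd f b t G : emap f (upd b t G) = upd b (f t) (emap f G).
Proof.
  destruct b; auto. extensionality y. unfold emap; cbn. destruct (string_dec y x); auto.
Qed.

Lemma emap_up_sub {A} s (G : env A) :
  emap (tsubst (up_sub s)) (emap tshift G) = emap tshift (emap (tsubst s) G).
Proof.
  rewrite !emap_emap. f_equal. extensionality t. apply tsubst_tshift.
Qed.

Lemma op_typed_tsubst s o t u r :
  op_typed o t u r -> op_typed o (tsubst s t) (tsubst s u) (tsubst s r).
Proof. destruct 1; cbn; try constructor. rewrite tsubst_tshift. constructor. Qed.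

Lemma lit_typed_tsubst s l t : lit_typed l t -> lit_typed l (tsubst s t).
Proof. destruct 1; constructor. Qed.

Lemma un_op_typed_tsubst s o t u : un_op_typed o t u -> un_op_typed o (tsubst s t) (tsubst s u).
Proof. destruct 1; constructor. Qed.

Lemma bin_op_typed_tsubst s o t u r :
  bin_op_typed o t u r -> bin_op_typed o (tsubst s t) (tsubst s u) (tsubst s r).
Proof.
  destruct 1 as [| | | | |t Ht|]; constructor.
  destruct Ht as [->|[->|[->| ->]]]; unfold base_ty; auto.
Qed.

Lemma rel_vrel_tsubst :
  (forall S G e1 e2 e3 t, rel S G e1 e2 e3 t -> forall s,
     rel (emap (tsubst s) S) (emap (tsubst s) G) e1 e2 e3 (tsubst s t)) /\
  (forall S v1 v2 v3 t, vrel S v1 v2 v3 t -> forall s,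
     vrel (emap (tsubst s) S) v1 v2 v3 (tsubst s t)).
Proof.
  apply rel_vrel_ind; intros; cbn [tsubst] in *;
    repeat match goal with
    | Hs : forall s, rel (emap _ (emap tshift _)) _ _ _ _ _ |- _ => specialize (Hs (up_sub s))
    | Hs : forall s, rel _ _ _ _ _ _ |- _ => specialize (Hs s)
    | Hs : forall s, vrel _ _ _ _ _ |- _ => specialize (Hs s)
    end;
    rewrite ?tsubst_tapps, ?tsubst_tsubst1, ?emap_upd, ?emap_up_sub, ?tsubst_tshift in *;
    cbn [tsubst] in *;
    try (econstructor; eauto using teq_tsubst, op_typed_tsubst, lit_typed_tsubst,
      un_op_typed_tsubst, bin_op_typed_tsubst; fail).
  - constructor. unfold emap. rewrite e. reflexivity.
  - apply vrel_Loc. unfold emap. rewrite e. reflexivity.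
Qed.

Definition ext (S S' : env loc) : Prop := forall l t, S l = Some t -> S' l = Some t.

Lemma ext_emap f S S' : ext S S' -> ext (emap f S) (emap f S').
Proof.
  intros He l t. unfold emap. destruct (S l) eqn:E; [|discriminate].
  rewrite (He _ _ E). auto.
Qed.

Lemma rel_vrel_ext :
  (forall S G e1 e2 e3 t, rel S G e1 e2 e3 t -> forall S', ext S S' ->
     rel S' G e1 e2 e3 t) /\
  (forall S v1 v2 v3 t, vrel S v1 v2 v3 t -> forall S', ext S S' -> vrel S' v1 v2 v3 t).
Proof.
  apply rel_vrel_ind; intros; solve [econstructor; eauto using ext_emap].
Qed.

(** Opens an existential: [w] may mention the type variable being instantiated, whereas the shifted
    store typing and environment return unchanged. *)
Lemma rel_tsubst1_upd S G b w e1 e2 e3 t u :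
  rel (emap tshift S) (upd b w (emap tshift G)) e1 e2 e3 t ->
  rel S (upd b (tsubst1 w u) G) e1 e2 e3 (tsubst1 t u).
Proof.
  intros Hr.
  apply (proj1 rel_vrel_tsubst) with (s := scons u TVar) in Hr.
  assert (Hid : forall A (F : env A), emap (tsubst (scons u TVar)) (emap tshift F) = F).
  { intros A F. rewrite emap_emap. extensionality x. unfold emap.
    destruct (F x); cbn; auto. f_equal. apply tsubst1_tshift. }
  rewrite emap_upd, !Hid in Hr. exact Hr.
Qed.

Lemma rel_tsubst1 S G e1 e2 e3 t u :
  rel (emap tshift S) (emap tshift G) e1 e2 e3 t -> rel S G e1 e2 e3 (tsubst1 t u).
Proof. apply rel_tsubst1_upd with (b := BAnon) (w := TUnit). Qed.

Lemma rel_tshift S G e1 e2 e3 t :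
  rel S G e1 e2 e3 t -> rel (emap tshift S) (emap tshift G) e1 e2 e3 (tshift t).
Proof.
  intros Hr. apply (proj1 rel_vrel_tsubst) with (s := fun n => TVar (Datatypes.S n)) in Hr.
  assert (Hf : tsubst (fun n => TVar (Datatypes.S n)) = tshift).
  { extensionality u. symmetry. apply tren_tsubst_TVar. }
  rewrite Hf in Hr. exact Hr.
Qed.

(** The inversion starts from the prover: the ideal body of [auth] is its bare argument, so a value
    on the ideal side would not force the others to be values. *)
Lemma rel_Val_inv S G v e2 e3 t : rel S G (Val v) e2 e3 t ->
  exists v2 v3 t0, e2 = Val v2 /\ e3 = Val v3 /\ teq t0 t /\ vrel S v v2 v3 t0.
Proof.
  intros Hr. remember (Val v) as e eqn:E. revert v E.
  induction Hr; intros w E; try discriminate.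
  - destruct (IHHr w E) as (v2 & v3 & t0 & ? & ? & ? & ?).
    exists v2, v3, t0. eauto using teq_trans.
  - injection E as ->. eauto 8 using teq_refl.
  (* Each operation's prover body is an abstraction, never of the form [Val]. *)
  - destruct o; cbn in E; repeat match goal with Ha : atom _ _ _ _ |- _ => destruct Ha end;
      discriminate.
Qed.

Lemma rel_Val_env S G G' v e2 e3 t : rel S G (Val v) e2 e3 t -> rel S G' (Val v) e2 e3 t.
Proof.
  intros Hr. destruct (rel_Val_inv _ _ _ _ _ _ Hr) as (v2 & v3 & t0 & -> & -> & ? & ?).
  econstructor; eauto using rel_Val.
Qed.

(** * Substitution of values *)

Definition bound_vars (b : binder) : list string :=
  match b with BAnon => [] | BNamed x => [x] end.

(** A boolean test, so that closedness of concrete library code is settled by computation. *)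
Fixpoint closed_in (L : list string) (e : expr) : bool :=
  match e with
  | Val _ => true
  | Var x => existsb (String.eqb x) L
  | Rec f x e => closed_in (bound_vars f ++ bound_vars x ++ L) e
  | App e1 e2 | BinOp _ e1 e2 | Pair e1 e2 | Store e1 e2 => closed_in L e1 && closed_in L e2
  | Substr e0 e1 e2 | If e0 e1 e2 | Case e0 e1 e2 =>
      closed_in L e0 && closed_in L e1 && closed_in L e2
  | UnOp _ e | Fst e | Snd e | InjL e | InjR e | Fold e | Unfold e | TLamE e | TAppE e
  | Pack e | Alloc e | Deref e | Hash e => closed_in L e
  | Unpack e1 x e2 => closed_in L e1 && closed_in (bound_vars x ++ L) e2
  end.

Lemma subst_closed_in L x v e : closed_in L e = true -> ~ In x L -> subst x v e = e.
Proof.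
  assert (Hb : forall b L, binder_is x b = false -> ~ In x L -> ~ In x (bound_vars b ++ L)).
  { intros [|y] L' E HL; cbn in *; auto. destruct (string_dec x y); [discriminate|].
    intros [->|?]; auto. }
  revert L; induction e; intros L Hc HL; cbn in *; rewrite ?andb_true_iff in Hc;
    try (f_equal; eauto; fail); try (f_equal; intuition eauto; fail).
  - destruct (string_dec x x0); auto. subst. apply existsb_exists in Hc as (y & Hy & E).
    apply String.eqb_eq in E. subst. tauto.
  - destruct (binder_is x f) eqn:Ef; cbn; auto. destruct (binder_is x x0) eqn:Ex; auto.
    f_equal. eauto.
  - destruct Hc as (Hc1 & Hc2). destruct (binder_is x x0) eqn:Ex; f_equal; eauto.
Qed.

(** If [x] names a parameter, both sides compute to the same term; otherwise the body has no free
    occurrence of [x]. *)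
Lemma subst_op_expr x v j o a1 a2 a3 b1 b2 b3 e e' :
  o <> OUnauth2 -> atom (op_var1 o) a1 a2 a3 -> atom (op_var2 Prover o) b1 b2 b3 ->
  In e [a1; a2; a3] -> In e' [b1; b2; b3] ->
  subst x v (op_expr j o e e') = op_expr j o (subst x v e) (subst x v e').
Proof.
  intros Ho Ha Hb He He'.
  assert (Ha' : e = Var (op_var1 o) \/ exists w, e = Val w)
    by (destruct Ha; cbn in He; intuition eauto).
  assert (Hb' : e' = Var (op_var2 Prover o) \/ exists w, e' = Val w)
    by (destruct Hb; cbn in He'; intuition eauto).
  clear Ha Hb He He'.
  destruct (in_dec string_dec x [op_var1 o; op_var2 Prover o]) as [Hin|Hin].
  - destruct Hin as [<-|[<-|[]]]; destruct Ha' as [->|(w & ->)], Hb' as [->|(w' & ->)];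
      destruct o; try (destruct Ho; reflexivity); destruct j; reflexivity.
  - transitivity (op_expr j o e e').
    + apply subst_closed_in with [op_var1 o; op_var2 Prover o]; auto.
      destruct Ha' as [->|(w & ->)], Hb' as [->|(w' & ->)];
      destruct o; try (destruct Ho; reflexivity); destruct j; reflexivity.
    + cbn in Hin. f_equal; [destruct Ha' as [->|(w & ->)]|destruct Hb' as [->|(w' & ->)]];
        cbn; auto; destruct string_dec; auto; subst; exfalso; auto.
Qed.

Lemma subst_atom x v1 v2 v3 y e1 e2 e3 :
  atom y e1 e2 e3 -> atom y (subst x v1 e1) (subst x v2 e2) (subst x v3 e3).
Proof. destruct 1; cbn; [destruct string_dec|]; constructor. Qed.

Lemma upd_shadow b x t u G :
  binder_is x b = true -> upd b u (upd (BNamed x) t G) = upd b u G.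
Proof.
  intros E. extensionality z. destruct b as [|y]; cbn in *; [discriminate|].
  repeat destruct string_dec; subst; try discriminate; congruence.
Qed.

Lemma upd_comm y x t u G :
  binder_is x y = false -> upd y u (upd (BNamed x) t G) = upd (BNamed x) t (upd y u G).
Proof.
  intros E. extensionality z. destruct y as [|y]; cbn in *; auto;
    repeat destruct string_dec; subst; try discriminate; congruence.
Qed.

Lemma rel_subst S G G' y t v1 v2 v3 e1 e2 e3 u :
  rel S G' e1 e2 e3 u -> G' = upd (BNamed y) t G ->
  rel S nil_env (Val v1) (Val v2) (Val v3) t ->
  rel S G (subst y v1 e1) (subst y v2 e2) (subst y v3 e3) u.
Proof.
  intros Hr; revert G t; induction Hr; intros G0 t0 -> Hv;
    try (cbn; econstructor; eauto; fail).
  - erewrite !subst_op_expr by (eauto; cbn; auto).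
    eapply rel_Op; eauto using subst_atom.
  - cbn. eapply rel_Auth; eauto using subst_atom.
  - cbn in *. destruct (string_dec y x) as [<-|Hx].
    + destruct (string_dec y y); [|congruence]. injection H0 as ->. eauto using rel_Val_env.
    + destruct (string_dec x y); [congruence|]. apply rel_Var; auto.
  - cbn. apply rel_Rec. destruct (binder_is y x) eqn:Ex; rewrite ?orb_true_r, ?orb_false_r.
    + rewrite upd_shadow in Hr by auto. auto.
    + rewrite (upd_comm x) in * by auto. destruct (binder_is y f) eqn:Ef.
      * rewrite upd_shadow in Hr by auto. auto.
      * rewrite upd_comm in * by auto. eapply IHHr; eauto.
  - cbn. apply rel_TLam. apply rel_tshift in Hv. eapply IHHr; eauto. apply emap_upd.
  - cbn. eapply rel_Unpack; eauto. rewrite emap_upd in *. destruct (binder_is y x) eqn:E.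
    + rewrite upd_shadow in Hr2 by auto. auto.
    + apply rel_tshift in Hv. eapply IHHr2; eauto. apply upd_comm; auto.
Qed.

Lemma rel_subst' S G b t v1 v2 v3 e1 e2 e3 u :
  rel S (upd b t G) e1 e2 e3 u ->
  rel S nil_env (Val v1) (Val v2) (Val v3) t ->
  rel S G (subst' b v1 e1) (subst' b v2 e2) (subst' b v3 e3) u.
Proof. destruct b; intros; [auto|eapply rel_subst; eauto]. Qed.

End Relation.

(** * Strings and framing *)

Lemma substring_app pre s post :
  substring (String.length pre) (String.length s) (pre ++ s ++ post) = s.
Proof.
  induction pre as [|c pre IH]; cbn; auto.
  induction s as [|c s IH]; cbn; [destruct post; reflexivity|]. f_equal. exact IH.
Qed.

Lemma length_app s t : String.length (s ++ t) = String.length s + String.length t.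
Proof. induction s; cbn; auto. Qed.

Lemma app_assoc_string s t u : ((s ++ t) ++ u)%string = s ++ t ++ u.
Proof. induction s; cbn; congruence. Qed.

Lemma app_nil_string s : (s ++ "")%string = s.
Proof. induction s; cbn; congruence. Qed.

Fixpoint no_colon (s : string) : Prop :=
  match s with EmptyString => True | String c s => c <> ":"%char /\ no_colon s end.

(** The first colon after the start of a frame therefore ends its length prefix, even when the
    payload contains colons. *)
Lemma no_colon_int_to_string n : no_colon (int_to_string n).
Proof.
  assert (Hraw : forall p s, no_colon s -> no_colon (BinaryString.Raw.of_pos p s)).
  { induction p; intros s Hs; cbn; try apply IHp; cbn; split; auto; discriminate. }
  destruct n; cbn; repeat split; try discriminate; apply Hraw; exact I.
Qed.

Lemma string_to_int_to_string n : string_to_int (int_to_string n) = Some n.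
Proof.
  unfold string_to_int, int_to_string. rewrite BinaryString.Z_of_of_Z.
  destruct string_dec; congruence.
Qed.

(** Symbolic evaluation, directed by the syntax. String and integer primitives stay folded so that
    equations about them apply, and known evaluations are used before unfolding further. Only [Case]
    leaves a choice of rule, settled by evaluating the scrutinee. *)
Ltac ev :=
  cbn -[substring String.length int_to_string string_to_int Z.of_nat Z.to_nat Z.sub Z.add
        Z.leb append lit_eq_dec parseFrameE frameE];
  match goal with
  | |- big _ _ (Val _) _ _ _ => apply big_Val
  | _ => eassumption
  | |- big _ _ (App _ _) _ _ _ => eapply big_App
  | |- big _ _ (If _ _ _) _ _ _ => eapply big_If
  | |- big _ _ (Case _ _ _) _ _ _ =>
      first [eapply big_CaseR; [solve [evs]|] | eapply big_CaseL; [solve [evs]|]]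
  | |- big _ _ _ _ _ _ => econstructor
  | |- _ = Some _ => reflexivity
  end
with evs := repeat ev.

Local Notation lstr s := (LitV (LString s)).
Local Notation lint n := (LitV (LInt n)).
Local Notation slen s := (Z.of_nat (String.length s)).

Section Framing.
Context {I : Type} (hashf : I -> string -> string).

(** Function and arguments are arbitrary effect-free expressions because the recursive call passes
    the unevaluated [j + 1]. Each iteration moves one character from [mid] to [pre]. *)
Lemma find_colon f es ej n1 n2 n3 pre mid post s j r σ :
  no_colon mid ->
  big hashf n1 f σ (to_val findColonE) σ -> big hashf n2 es σ (lstr s) σ ->
  big hashf n3 ej σ (lint j) σ ->
  s = pre ++ mid ++ ":" ++ post -> j = slen pre -> r = slen (pre ++ mid) ->
  evals hashf (App2 f es ej) σ (InjRV (lint r)) σ.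
Proof.
  intros Hm; revert f es ej n1 n2 n3 pre j; induction mid as [|c mid IH];
    intros f es ej n1 n2 n3 pre j Hf Hes Hej Hs Hj Hr.
  - cbn in Hf. eexists. evs.
    replace (slen s <=? j)%Z with false
      by (symmetry; apply Z.leb_gt; subst; rewrite !length_app; cbn [String.length]; lia).
    evs. replace (substring (Z.to_nat j) (Z.to_nat 1) s) with ":"
      by (subst; rewrite Nat2Z.id; symmetry; apply (substring_app pre ":" post)).
    subst. rewrite app_nil_string. cbn. evs.
  - destruct Hm as (Hc & Hm).
    edestruct (IH Hm (Val (to_val findColonE)) (Val (lstr s))
      (BinOp PlusOp (Val (lint j)) (Val (lint 1))) 0 0 1 (pre ++ String c "") (j + 1)%Z)
      as (n' & Hn).
    + constructor.
    + constructor.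
    + eapply (big_BinOp hashf 0 0); [constructor|constructor|reflexivity].
    + subst. rewrite !app_assoc_string. reflexivity.
    + subst. rewrite length_app. cbn [String.length]. lia.
    + subst. rewrite !app_assoc_string. reflexivity.
    + cbn in Hf, Hn. eexists. evs.
      replace (slen s <=? j)%Z with false
        by (symmetry; apply Z.leb_gt; subst; rewrite !length_app; cbn [String.length]; lia).
      evs. replace (substring (Z.to_nat j) (Z.to_nat 1) s) with (String c "")
        by (subst; rewrite Nat2Z.id; symmetry; apply (substring_app pre (String c "") _)).
      destruct lit_eq_dec as [E|_]; [congruence|]. exact Hn.
Qed.

Lemma parse_frame es ek n2 n3 pre t post s k r σ :
  big hashf n2 es σ (lstr s) σ -> big hashf n3 ek σ (lint k) σ ->
  s = pre ++ frame t ++ post -> k = slen pre -> r = slen (pre ++ frame t) ->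
  evals hashf (App2 parseFrameE es ek) σ (InjRV (PairV (lstr t) (lint r))) σ.
Proof.
  intros Hes Hek Hs Hk Hr. unfold frame in *.
  set (d := int_to_string (slen t)) in *.
  assert (Hd : no_colon d) by apply no_colon_int_to_string.
  destruct (find_colon findColonE (Val (lstr s)) (Val (lint k)) 0 0 0 pre d (t ++ post) s k
    (slen (pre ++ d)) σ) as (n & Hn); auto; try constructor.
  { subst s. rewrite !app_assoc_string. reflexivity. }
  (* The 1 accounts for the colon between length prefix and payload. *)
  assert (Hr' : (slen (pre ++ d) + 1 + slen t = r)%Z)
    by (subst r; rewrite !length_app; cbn [String.length]; lia).
  assert (Hint : evals hashf (UnOp StrToIntOp (Substr (Val (lstr s)) (Val (lint k))
    (BinOp MinusOp (Val (lint (slen (pre ++ d)))) (Val (lint k))))) σ (InjRV (lint (slen t))) σ).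
  { eexists. evs. cbn -[substring String.length int_to_string string_to_int Z.of_nat Z.to_nat Z.sub].
    replace (substring (Z.to_nat k) (Z.to_nat (slen (pre ++ d) - k)) s) with d.
    - unfold d at 1. rewrite string_to_int_to_string. reflexivity.
    - subst. rewrite Nat2Z.id, length_app.
      replace (Z.to_nat _) with (String.length d) by lia.
      symmetry. rewrite app_assoc_string. apply substring_app. }
  destruct Hint as (n' & Hint).
  eexists. evs.
  replace (0 <=? slen t)%Z with true by (symmetry; apply Z.leb_le; lia).
  evs. rewrite Hr'.
  replace (r <=? slen s)%Z with true
    by (symmetry; apply Z.leb_le; subst; rewrite !length_app; cbn [String.length]; lia).
  evs.
  - replace t with (substring (Z.to_nat (slen (pre ++ d) + 1)) (Z.to_nat (slen t)) s) at 2.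
    + evs.
    + subst s. rewrite Nat2Z.id. transitivity (substring (String.length (pre ++ d ++ ":"))
        (String.length t) ((pre ++ d ++ ":") ++ t ++ post)); [|apply substring_app].
      rewrite !length_app, !app_assoc_string. cbn [String.length]. f_equal. lia.
  - cbn -[Z.add Z.of_nat]. rewrite Hr'. reflexivity.
Qed.

Lemma eval_frame e s σ σ' :
  evals hashf e σ (lstr s) σ' -> evals hashf (App frameE e) σ (lstr (frame s)) σ'.
Proof.
  intros (n & He). unfold frame. rewrite <- app_assoc_string. eexists. evs.
Qed.

End Framing.

(** * Canonical forms *)

Section Canonical.
Context (H : string -> string).
Notation rel := (rel H).
Notation vrel := (vrel H).
Notation vals S a b c t := (rel S nil_env (Val a) (Val b) (Val c) t).

Ltac use_sim Ht :=
  apply teq_sim in Ht; [cbn in Ht|solve [auto using rigid_tapps|apply rigid_tapps; exact I|exact I]..].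

(** Only value rules whose type has the right head survive conversion. Arrow types have two:
    closures with common binders, and [unauth] applied to its evidence. *)
Lemma canonical S G v e2 e3 t : rel S G (Val v) e2 e3 t ->
  exists v2 v3, e2 = Val v2 /\ e3 = Val v3 /\
  match t with
  | TUnit => v = LitV LUnit /\ v2 = v /\ v3 = v
  | TBool => exists b, v = LitV (LBool b) /\ v2 = v /\ v3 = v
  | TInt => exists n, v = LitV (LInt n) /\ v2 = v /\ v3 = v
  | TString => exists s, v = LitV (LString s) /\ v2 = v /\ v3 = v
  | TProd t u => exists a a' a'' b b' b'', v = PairV a b /\ v2 = PairV a' b' /\ v3 = PairV a'' b'' /\
      vals S a a' a'' t /\ vals S b b' b'' u
  | TSum t u => exists a a' a'',
      v = InjLV a /\ v2 = InjLV a' /\ v3 = InjLV a'' /\ vals S a a' a'' t \/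
      v = InjRV a /\ v2 = InjRV a' /\ v3 = InjRV a'' /\ vals S a a' a'' u
  | TRef t => exists l t', v = LitV (LLoc l) /\ v2 = v /\ v3 = v /\ S l = Some t' /\ teq t' t
  | TForall k t => exists e e' e'', v = TLamV e /\ v2 = TLamV e' /\ v3 = TLamV e'' /\
      forall u, rel S nil_env e e' e'' (tsubst1 t u)
  | TExists k t => exists a a' a'' u, v = PackV a /\ v2 = PackV a' /\ v3 = PackV a'' /\
      vals S a a' a'' (tsubst1 t u)
  | TArr t u =>
      (exists f x e e' e'', v = RecV f x e /\ v2 = RecV f x e' /\ v3 = RecV f x e'' /\
        forall a a' a'', vals S a a' a'' t ->
          rel S nil_env (subst' x a (subst' f v e)) (subst' x a' (subst' f v2 e'))
            (subst' x a'' (subst' f v3 e'')) u) \/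
      (exists a a' a'' b b' b'' w,
        v = op_val Prover OUnauth1 a b /\ v2 = op_val Verifier OUnauth1 a' b' /\
        v3 = op_val Ideal OUnauth1 a'' b'' /\ vals S a a' a'' (tevi w) /\
        teq t (tauth w) /\ teq u (tm w))
  | TApp TUnit t => exists a a' a'' s, v = PairV a (LitV (LString (H s))) /\
      v2 = LitV (LString (H s)) /\ v3 = a'' /\ vals S a a' a'' t /\ ser a a' s
  | _ => True
  end.
Proof.
  intros Hr. destruct (rel_Val_inv _ _ _ _ _ _ _ Hr) as (v2 & v3 & t0 & -> & -> & Ht & Hv).
  exists v2, v3. repeat split.
  destruct t; auto; try match goal with |- match ?x with _ => _ end => destruct x; auto end.
  all: destruct Hv; try match goal with Hl : lit_typed _ _ |- _ => destruct Hl
       | Ho : op_typed _ _ _ _ |- _ => destruct Ho end.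
  all: try (use_sim Ht; tauto).
  all: try (apply teq_sim in Ht; [|apply rigid_tapps; exact I|exact I];
            apply sim_mu_headed in Ht; [|apply mu_headed_tapps; exact I]; destruct Ht; fail).
  all: use_sim Ht.
  all: try (destruct Ht as (Ht1 & Ht2)).
  all: try (repeat eexists; eauto using rel_conv; fail).
  - eexists _, _, _. left. repeat split; eauto using rel_conv.
  - eexists _, _, _. right. repeat split; eauto using rel_conv.
  - left. repeat eexists. intros a a' a'' Ha.
    apply rel_conv with u; auto. eapply rel_subst'; [eapply rel_subst'; eauto|].
    + apply rel_Val, vrel_Rec; auto.
    + eapply rel_conv; eauto using teq_sym.
  - right. repeat eexists; eauto using teq_sym.
  - repeat eexists. intros u. eapply rel_conv; [apply rel_tsubst1; eassumption|].
    apply teq_tsubst1; auto using teq_refl.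
  - subst. repeat eexists. eapply rel_conv; eauto. apply teq_tsubst1; auto using teq_refl.
Qed.

(** Stated apart from [canonical], whose case distinction on the type is stuck on an unknown
    argument list. *)
Lemma canonical_mu S G v e2 e3 k F args : rel S G (Val v) e2 e3 (tapps (TMu k F) args) ->
  exists a a' a'', v = FoldV a /\ e2 = Val (FoldV a') /\ e3 = Val (FoldV a'') /\
    vals S a a' a'' (tapps (tsubst1 F (TMu k F)) args).
Proof.
  intros Hr. destruct (rel_Val_inv _ _ _ _ _ _ _ Hr) as (v2 & v3 & t0 & -> & -> & Ht & Hv).
  destruct Hv.
  (* This is the case [vrel_Fold]; the types of all other rules have a different head. *)
  7: { repeat eexists. eapply rel_conv; eauto using teq_unfold. }
  all: try match goal with Hl : lit_typed _ _ |- _ => destruct Hl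
       | Ho : op_typed _ _ _ _ |- _ => destruct Ho end.
  all: apply teq_sym, teq_sim in Ht; [|apply rigid_tapps; exact I|exact I];
       apply sim_mu_headed in Ht; [destruct Ht|apply mu_headed_tapps; exact I].
Qed.

End Canonical.

(** * Evidence *)
Section Evidence.
Context {I : Type} (hashf : I -> string -> string) (i : I).
Notation hash := (hashf i).
Notation rel := (rel hash).
Notation vrel := (vrel hash).
Notation vals S a b c t := (rel S nil_env (Val a) (Val b) (Val c) t).

Definition call (f x : binder) (e : expr) (v : val) : expr := subst' x v (subst' f (RecV f x e) e).

Ltac inv_big :=
  repeat (match goal with
  | Hb : big _ _ ?e _ _ _ |- _ =>
      lazymatch e with
      | Val _ => idtac | Rec _ _ _ => idtac | App _ _ => idtac | BinOp _ _ _ => idtac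
      | UnOp _ _ => idtac | Fst _ => idtac | Snd _ => idtac | Case _ _ _ => idtac
      | Unfold _ => idtac | Pair _ _ => idtac | Fold _ => idtac | InjR _ => idtac
      | InjL _ => idtac | Hash _ => idtac
      end; inversion Hb; clear Hb; subst
  | Hb : un_op_eval _ _ = Some _ |- _ => cbn in Hb; injection Hb as <-
  | Hb : bin_op_eval _ _ _ = Some _ |- _ => cbn in Hb; injection Hb as <-
  end; cbn -[int_to_string String.length Z.of_nat append] in *).

(** The prover's serializer only has to be inverted, hence partial correctness; the verifier's two
    functions must be shown to evaluate. All leave the state unchanged, so evidence can be used at
    any point of a run. *)
Definition evidence (S : env loc) (ev ev' : val) (t : ty) : Prop :=
  exists f x b g y c h z d, ev = RecV f x b /\ ev' = PairV (RecV g y c) (RecV h z d) /\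
  forall a a' a'', vals S a a' a'' t -> exists s, ser a a' s /\
    (forall n σ v σ', big hashf n (call f x b a) σ v σ' -> v = lstr s /\ σ' = σ) /\
    (forall σ, evals hashf (call g y c a') σ (lstr s) σ) /\
    (forall σ, evals hashf (call h z d (lstr s)) σ (InjRV a') σ).

Lemma eval_head_is es n c c' r σ :
  big hashf n es σ (lstr (String c r)) σ ->
  evals hashf (HeadIs (String c' "") es) σ (LitV (LBool (Ascii.eqb c c'))) σ.
Proof.
  intros He. eexists. evs. change (Z.to_nat 0) with 0. change (Z.to_nat 1) with 1.
  cbn -[lit_eq_dec]. do 3 f_equal.
  replace (substring 0 0 r) with "" by (destruct r; reflexivity).
  destruct (Ascii.eqb_spec c c') as [->|Hc]; destruct lit_eq_dec; congruence.
Qed.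

Lemma eval_rest es n c r σ :
  big hashf n es σ (lstr (String c r)) σ -> evals hashf (Rest es) σ (lstr r) σ.
Proof.
  intros He.
  assert (Hr : substring (Z.to_nat 1) (Z.to_nat (slen (String c r) - 1)) (String c r) = r).
  { replace (Z.to_nat (slen (String c r) - 1)) with (String.length r)
      by (cbn [String.length]; lia).
    generalize (substring_app (String c "") r ""). rewrite app_nil_string. auto. }
  rewrite <- Hr. eexists. unfold Rest. evs.
Qed.

Lemma eval_eq_refl e1 e2 n1 n2 l σ :
  big hashf n1 e1 σ (LitV l) σ -> big hashf n2 e2 σ (LitV l) σ ->
  evals hashf (EEq e1 e2) σ (LitV (LBool true)) σ.
Proof.
  intros H1 H2. eexists. evs. cbn -[lit_eq_dec]. destruct lit_eq_dec; congruence.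
Qed.

Ltac inv_some :=
  repeat (cbn -[int_to_string String.length Z.of_nat append] in *;
    match goal with Hx : Some _ = Some _ |- _ => injection Hx as <- end).

(** The hypotheses on arguments are guarded by their types, so that one statement covers combinators
    of every arity. *)
Lemma op_evidence S o v1 v2 w1 w2 t u r t0 :
  op_typed o t u r -> teq r (tevi t0) ->
  (forall t', teq t (tevi t') -> evidence S v1 v2 t') ->
  (forall u', teq u (tevi u') -> evidence S w1 w2 u') ->
  evidence S (op_val Prover o v1 w1) (op_val Verifier o v2 w2) t0.
Proof.
  intros Ho Hr Hv Hw.
  assert (exists t', r = tevi t' /\ teq t' t0) as (t' & -> & Ht').
  { destruct Ho; apply teq_sim in Hr; cbn in Hr; auto; try tauto; repeat eexists; tauto. }
  clear Hr. inversion Ho; subst; clear Ho; unfold op_val; cbn -[parseFrameE frameE].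
  - do 9 eexists; (split; [reflexivity|]); (split; [reflexivity|]); intros a a' a'' Ha.
    assert (Ha' : vals S a a' a'' (tauth t1)) by eauto using rel_conv, teq_sym.
    apply canonical in Ha' as (? & ? & [= <-] & [= <-] & b & b' & b'' & s & -> & -> & -> & Hb & Hs).
    eexists. split; [constructor|]. split; [|split].
    + intros n σ v σ' Hb'. unfold call in Hb'. cbn in Hb'. inv_big. auto.
    + intros σ. eexists. unfold call. evs.
    + intros σ. eexists. unfold call. evs.
  - destruct (Hv _ (teq_refl _)) as (f & x & b & g & y & c & h & z & d & -> & -> & Hev).
    destruct (Hw _ (teq_refl _)) as (f' & x' & b' & g' & y' & c' & h' & z' & d' & -> & -> & Hev').
    do 9 eexists; (split; [reflexivity|]); (split; [reflexivity|]); intros a a' a'' Ha.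
    assert (Ha' : vals S a a' a'' (TProd t1 u0)) by eauto using rel_conv, teq_sym.
    apply canonical in Ha'
      as (? & ? & [= <-] & [= <-] & a1 & a1' & a1'' & a2 & a2' & a2'' & -> & -> & -> & H1 & H2).
    destruct (Hev _ _ _ H1) as (s1 & Hs1 & HP1 & HV1 & HD1).
    destruct (Hev' _ _ _ H2) as (s2 & Hs2 & HP2 & HV2 & HD2).
    eexists. split; [constructor; eassumption|]. split; [|split]; unfold call at 1.
    + intros n σ v σ' Hb. cbn in Hb. inv_big.
      match goal with Hb : big _ _ _ _ _ σ' |- _ => apply HP2 in Hb as (-> & ->) end.
      match goal with Hb : big _ _ _ _ _ _ |- _ => apply HP1 in Hb as (-> & ->) end.
      inv_some. unfold frame. cbn. rewrite !app_assoc_string. auto.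
    + intros σ. destruct (HV1 σ) as (n1 & Hn1), (HV2 σ) as (n2 & Hn2).
      destruct (eval_frame hashf (App (Fst (Val (PairV (RecV g y c) (RecV h z d))))
        (Fst (Val (PairV a1' a2')))) s1 σ σ); [eexists; evs|].
      destruct (eval_frame hashf (App (Fst (Val (PairV (RecV g' y' c') (RecV h' z' d'))))
        (Snd (Val (PairV a1' a2')))) s2 σ σ); [eexists; evs|].
      rewrite <- app_assoc_string. eexists. evs.
    + intros σ. destruct (HD1 σ) as (n1 & Hn1), (HD2 σ) as (n2 & Hn2).
      set (s := "P" ++ frame s1 ++ frame s2) in *.
      destruct (eval_head_is (Val (lstr s)) 0 "P" "P" (frame s1 ++ frame s2) σ); [constructor|].
      destruct (parse_frame hashf (Val (lstr s)) (Val (lint 1)) 0 0 "P" s1 (frame s2) s 1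
        (slen ("P" ++ frame s1)) σ); try constructor.
      (* The second frame starts where the first ends and has empty remainder, so its end position
         passes the final length check. *)
      destruct (parse_frame hashf (Val (lstr s))
        (Snd (Val (PairV (lstr s1) (lint (slen ("P" ++ frame s1)))))) 0 1 ("P" ++ frame s1) s2 "" s
        (slen ("P" ++ frame s1)) (slen s) σ); try constructor.
      { eapply big_Snd. constructor. }
      { rewrite app_nil_string, app_assoc_string. reflexivity. }
      destruct (eval_eq_refl (Snd (Val (PairV (lstr s2) (lint (slen s)))))
        (UnOp StrLenOp (Val (lstr s))) 1 1 (LInt (slen s)) σ); [evs|evs|].
      eexists. evs.
  - destruct (Hv _ (teq_refl _)) as (f & x & b & g & y & c & h & z & d & -> & -> & Hev).
    destruct (Hw _ (teq_refl _)) as (f' & x' & b' & g' & y' & c' & h' & z' & d' & -> & -> & Hev').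
    do 9 eexists; (split; [reflexivity|]); (split; [reflexivity|]); intros a a' a'' Ha.
    assert (Ha' : vals S a a' a'' (TSum t1 u0)) by eauto using rel_conv, teq_sym.
    apply canonical in Ha'
      as (? & ? & [= <-] & [= <-] & a1 & a1' & a1'' & [(-> & -> & -> & H1)|(-> & -> & -> & H1)]).
    + destruct (Hev _ _ _ H1) as (s & Hs & HP & HV & HD).
      eexists. split; [constructor; eassumption|]. split; [|split]; unfold call at 1.
      * intros n σ v σ' Hb. cbn in Hb. inv_big.
        match goal with Hb : big _ _ _ _ _ _ |- _ => apply HP in Hb as (-> & ->) end.
        inv_some. auto.
      * intros σ. destruct (HV σ) as (n & Hn). eexists. evs.
      * intros σ. destruct (HD σ) as (n & Hn).
        destruct (eval_head_is (Val (lstr ("L" ++ s))) 0 "L" "L" s σ); [constructor|].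
        destruct (eval_rest (Val (lstr ("L" ++ s))) 0 "L" s σ); [constructor|].
        eexists. evs.
    + destruct (Hev' _ _ _ H1) as (s & Hs & HP & HV & HD).
      eexists. split; [constructor; eassumption|]. split; [|split]; unfold call at 1.
      * intros n σ v σ' Hb. cbn in Hb. inv_big.
        match goal with Hb : big _ _ _ _ _ _ |- _ => apply HP in Hb as (-> & ->) end.
        inv_some. auto.
      * intros σ. destruct (HV σ) as (n & Hn). eexists. evs.
      * intros σ. destruct (HD σ) as (n & Hn).
        destruct (eval_head_is (Val (lstr ("R" ++ s))) 0 "R" "L" s σ); [constructor|].
        destruct (eval_head_is (Val (lstr ("R" ++ s))) 0 "R" "R" s σ); [constructor|].
        destruct (eval_rest (Val (lstr ("R" ++ s))) 0 "R" s σ); [constructor|].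
        eexists. evs.
  - do 9 eexists; (split; [reflexivity|]); (split; [reflexivity|]); intros a a' a'' Ha.
    assert (Ha' : vals S a a' a'' TString) by eauto using rel_conv, teq_sym.
    apply canonical in Ha' as (? & ? & [= <-] & [= <-] & s & -> & -> & ->).
    eexists. split; [constructor|]. split; [|split]; unfold call.
    + intros n σ v σ' Hb. cbn in Hb. inv_big. inv_some. auto.
    + intros σ. eexists. evs.
    + intros σ.
      destruct (eval_head_is (Val (lstr ("S" ++ s))) 0 "S" "S" s σ); [constructor|].
      destruct (eval_rest (Val (lstr ("S" ++ s))) 0 "S" s σ); [constructor|].
      eexists. evs.
  - do 9 eexists; (split; [reflexivity|]); (split; [reflexivity|]); intros a a' a'' Ha.
    assert (Ha' : vals S a a' a'' TInt) by eauto using rel_conv, teq_sym.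
    apply canonical in Ha' as (? & ? & [= <-] & [= <-] & k & -> & -> & ->).
    eexists. split; [constructor|]. split; [|split]; unfold call.
    + intros n σ v σ' Hb. cbn in Hb. inv_big. inv_some. auto.
    + intros σ. eexists. evs.
    + intros σ.
      destruct (eval_head_is (Val (lstr ("I" ++ int_to_string k))) 0 "I" "I" (int_to_string k) σ);
        [constructor|].
      destruct (eval_rest (Val (lstr ("I" ++ int_to_string k))) 0 "I" (int_to_string k) σ);
        [constructor|].
      eexists. evs. cbn -[int_to_string string_to_int]. rewrite string_to_int_to_string.
      reflexivity.
  - destruct (Hv _ (teq_refl _)) as (g & x & b & g' & y & c & h & z & d & -> & -> & Hev).
    do 9 eexists; (split; [reflexivity|]); (split; [reflexivity|]); intros a a' a'' Ha.
    set (F := TApp (tshift f) (TVar 0)) in *.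
    assert (Ha' : vals S a a' a'' (tapps (TMu KStar F) [])) by eauto using rel_conv, teq_sym.
    apply canonical_mu in Ha' as (a1 & a1' & a1'' & -> & [= ->] & [= ->] & H1).
    (* The unfolding is syntactically the type of the given evidence, since [tshift f] absorbs the
       substitution. *)
    assert (HF : tapps (tsubst1 F (TMu KStar F)) [] = TApp f (TMu KStar F)).
    { unfold F at 1. cbn. rewrite <- (tsubst1_tshift (TMu KStar F) f) at 2. reflexivity. }
    rewrite HF in H1.
    destruct (Hev _ _ _ H1) as (s & Hs & HP & HV & HD).
    eexists. split; [constructor; eassumption|]. split; [|split]; unfold call at 1.
    + intros n σ v σ' Hb. cbn in Hb. inv_big.
      match goal with Hb : big _ _ _ _ _ _ |- _ => apply HP in Hb as (-> & ->) end.
      auto.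
    + intros σ. destruct (HV σ) as (n & Hn). eexists. evs.
    + intros σ. destruct (HD σ) as (n & Hn). eexists. evs.
Qed.

(** A value of type [tevi t] can only come from [vrel_Op], so evidence is a finite tree of library
    combinators and induction on the derivation applies. *)
Theorem rel_evidence S ev e2 e3 t :
  rel S nil_env (Val ev) e2 e3 (tevi t) -> exists ev', e2 = Val ev' /\ evidence S ev ev' t.
Proof.
  intros Hr.
  enough (Hall : (forall S G e1 e2 e3 T, rel S G e1 e2 e3 T -> forall v, e1 = Val v ->
      forall t, teq T (tevi t) -> exists v', e2 = Val v' /\ evidence S v v' t) /\
    (forall S v v' v'' T, vrel S v v' v'' T -> forall t, teq T (tevi t) -> evidence S v v' t))
    by (eapply (proj1 Hall); eauto using teq_refl).
  clear. apply rel_vrel_ind; intros; try discriminate;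
    try (match goal with
      | Ht : teq _ _, Hl : lit_typed _ _ |- _ => destruct Hl
      | _ => idtac end;
      match goal with Ht : teq ?t _ |- _ =>
        apply teq_sim in Ht; [cbn in Ht; tauto|exact Logic.I|exact Logic.I] end; fail).
  - eauto using teq_trans.
  - match goal with E : Val _ = Val _ |- _ => injection E as <- end. eauto.
  - exfalso. destruct o; repeat match goal with Ha : atom _ _ _ _ |- _ => destruct Ha end;
      discriminate.
  - exfalso. match goal with Ht : teq _ _ |- _ =>
      apply teq_sim in Ht; [|apply rigid_tapps; exact Logic.I|exact Logic.I];
      apply sim_mu_headed in Ht; [exact Ht|apply mu_headed_tapps; exact Logic.I] end.
  - eapply op_evidence; eauto; intros t' Ht'.
    + edestruct H as (v' & [= <-] & He); eauto.
    + edestruct H0 as (v' & [= <-] & He); eauto.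
Qed.

End Evidence.

(** * The simulation *)

Section Simulation.
Context {I : Type} (hashf : I -> string -> string) (i : I).
Notation hash := (hashf i).
Notation rel := (rel hash).
Notation vrel := (vrel hash).
Notation vals S a b c t := (rel S nil_env (Val a) (Val b) (Val c) t).

(** The heaps share one domain. Histories are unconstrained, since the implementations hash at
    different points. *)
Definition states (S : env loc) (σ1 σ2 σ3 : state I) : Prop :=
  st_idx σ1 = i /\ st_idx σ2 = i /\ st_idx σ3 = i /\
  forall l, match S l with
  | None => st_heap σ1 l = None /\ st_heap σ2 l = None /\ st_heap σ3 l = None
  | Some t => exists v1 v2 v3, st_heap σ1 l = Some v1 /\ st_heap σ2 l = Some v2 /\
      st_heap σ3 l = Some v3 /\ vals S v1 v2 v3 t
  end.

Lemma states_init : states nil_env (init_state i) (init_state i) (init_state i).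
Proof. repeat split. Qed.

(** The two alternatives for [S l] serve allocation and assignment. *)
Lemma states_upd S l t m1 m2 m3 h1 h2 h3 v1 v2 v3 :
  states S (mkState m1 h1 i) (mkState m2 h2 i) (mkState m3 h3 i) ->
  (S l = None \/ S l = Some t) -> vals S v1 v2 v3 t ->
  exists S', ext S S' /\ S' l = Some t /\
    states S' (mkState (heap_upd m1 l v1) h1 i) (mkState (heap_upd m2 l v2) h2 i)
      (mkState (heap_upd m3 l v3) h3 i).
Proof.
  intros (_ & _ & _ & Hm) Hl Hv. cbn in Hm.
  exists (fun l' => if Nat.eq_dec l l' then Some t else S l').
  assert (He : ext S (fun l' => if Nat.eq_dec l l' then Some t else S l')).
  { intros l' t' E. destruct Nat.eq_dec as [<-|]; auto. destruct Hl; congruence. }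
  split; [exact He|split].
  - destruct (Nat.eq_dec l l); congruence.
  - repeat split. cbn. unfold heap_upd. intros l'. destruct (Nat.eq_dec l l').
    + repeat eexists. eapply (proj1 (rel_vrel_ext hash)); eauto.
    + specialize (Hm l'). destruct (S l'); auto.
      destruct Hm as (w1 & w2 & w3 & ? & ? & ? & ?). exists w1, w2, w3.
      repeat split; auto. eapply (proj1 (rel_vrel_ext hash)); eauto.
Qed.

Lemma states_hist S m1 m2 m3 h1 h2 h3 h1' h2' h3' :
  states S (mkState m1 h1 i) (mkState m2 h2 i) (mkState m3 h3 i) ->
  states S (mkState m1 h1' i) (mkState m2 h2' i) (mkState m3 h3' i).
Proof. intros (_ & _ & _ & Hm). repeat split. exact Hm. Qed.

Lemma rel_Var_nil S x e2 e3 t : ~ rel S nil_env (Var x) e2 e3 t.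
Proof.
  intros Hr. remember nil_env as G eqn:EG. remember (Var x) as e eqn:Ee.
  induction Hr; try discriminate; auto.
  - destruct o; repeat match goal with Ha : atom _ _ _ _ |- _ => destruct Ha end; discriminate.
  - subst. discriminate.
Qed.

Lemma atom_nil S x e1 e2 e3 t : atom x e1 e2 e3 -> rel S nil_env e1 e2 e3 t ->
  exists v1 v2 v3, e1 = Val v1 /\ e2 = Val v2 /\ e3 = Val v3.
Proof. destruct 1; intros Hr; [destruct (rel_Var_nil _ _ _ _ _ Hr)|repeat eexists]. Qed.

Lemma op_expr_evals j o v w σ : evals hashf (op_expr j o (Val v) (Val w)) σ (op_val j o v w) σ.
Proof. destruct j, o; unfold op_val; eexists; cbn -[parseFrameE frameE]; repeat econstructor. Qed.

Lemma op_expr_big n o v w σ r σ' :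
  big hashf n (op_expr Prover o (Val v) (Val w)) σ r σ' -> r = op_val Prover o v w /\ σ' = σ.
Proof. destruct o; intros Hb; inversion Hb; subst; auto. Qed.

Lemma un_op_rel S o t u v v2 v3 w :
  un_op_typed o t u -> vals S v v2 v3 t -> un_op_eval o v = Some w ->
  v2 = v /\ v3 = v /\ vals S w w w u.
Proof.
  intros Ho Hv Hw.
  destruct Ho; apply canonical in Hv as (? & ? & [= <-] & [= <-] & x & -> & -> & ->);
    injection Hw as <-; repeat split; try (apply rel_Val, vrel_Lit; constructor).
  apply rel_Val. destruct string_to_int; constructor; apply rel_Val, vrel_Lit; constructor.
Qed.

Lemma bin_op_rel S o t u r v v2 v3 w w2 w3 x :
  bin_op_typed o t u r -> vals S v v2 v3 t -> vals S w w2 w3 u -> bin_op_eval o v w = Some x ->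
  v2 = v /\ v3 = v /\ w2 = w /\ w3 = w /\ vals S x x x r.
Proof.
  intros Ho Hv Hw Hx.
  destruct Ho as [| | | | |t [->|[->|[->| ->]]]|];
    apply canonical in Hv as (? & ? & [= <-] & [= <-] & Hv);
    apply canonical in Hw as (? & ? & [= <-] & [= <-] & Hw);
    repeat match goal with
    | Hc : exists _, _ |- _ => destruct Hc as (? & ?) | Hc : _ /\ _ |- _ => destruct Hc end;
    subst; injection Hx as <-; repeat split; apply rel_Val, vrel_Lit; constructor.
Qed.

Definition simulated (S : env loc) (e2 e3 : expr) (t : ty) (σ2 σ3 : state I) (v : val)
    (σ1' : state I) : Prop :=
  exists S' v2 v3 σ2' σ3', ext S S' /\ states S' σ1' σ2' σ3' /\ vals S' v v2 v3 t /\
    evals hashf e2 σ2 v2 σ2' /\ evals hashf e3 σ3 v3 σ3'.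

Ltac weaken He :=
  lazymatch type of He with
  | ext ?Sa ?Sb =>
    repeat match goal with
    | Hr : rel Sa _ _ _ _ _ |- _ => apply (proj1 (rel_vrel_ext hash)) with (S' := Sb) in Hr; [|exact He]
    | Hr : rel (emap tshift Sa) _ _ _ _ _ |- _ =>
        apply (proj1 (rel_vrel_ext hash)) with (S' := emap tshift Sb) in Hr; [|apply ext_emap, He]
    end
  end.

(** Applies the induction hypothesis to the evaluation of [e] and transports the remaining relations
    to the extended store typing. *)
Ltac run e :=
  let S' := fresh "S'" in let v2 := fresh "v2" in let v3 := fresh "v3" in
  let He := fresh "Hext" in let Hst' := fresh "Hst" in let Hv := fresh "Hv" in
  let m2 := fresh "m2" in let m3 := fresh "m3" in
  let H2 := fresh "Hev" in let H3 := fresh "Hev" in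
  lazymatch goal with
  | Hst : states ?S _ _ _, Hb : big _ ?m e _ _ _, Hr : rel ?S nil_env e _ _ _,
    IH : forall m, m < ?n -> _ |- _ =>
    let Hm := fresh in
    assert (Hm : m < n) by lia;
    destruct (IH m Hm _ _ _ _ _ Hr _ _ _ _ _ Hst Hb)
      as (S' & v2 & v3 & ? & ? & He & Hst' & Hv & (m2 & H2) & (m3 & H3));
    clear Hm Hb Hst; weaken He
  end.

Ltac canon Hv := apply canonical in Hv as (? & ? & [= <-] & [= <-] & Hv).

Ltac finish := unfold simulated; do 5 eexists;
  split; [|split; [eassumption|split; [|split; eexists]]]; [solve [unfold ext in *; auto 10]|..].

(** Strong induction on the evaluation size handles calls, whose bodies are not subterms. The inner
    induction on the relation serves only [rel_conv], which leaves the expression unchanged. *)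
Theorem rel_simulated n : forall S e1 e2 e3 t, rel S nil_env e1 e2 e3 t ->
  forall σ1 σ2 σ3 v σ1', states S σ1 σ2 σ3 -> big hashf n e1 σ1 v σ1' ->
  simulated S e2 e3 t σ2 σ3 v σ1'.
Proof.
  induction n as [n IH] using lt_wf_ind. intros S e1 e2 e3 t Hr.
  assert (exists G, G = nil_env /\ rel S G e1 e2 e3 t) as (G & EG & Hr') by eauto.
  clear Hr; rename Hr' into Hr.
  induction Hr; intros σ1 σ2 σ3 v σ1' Hst Hb; subst G;
    repeat match goal with Hx : _ = _ -> _ |- _ => specialize (Hx eq_refl) end.
  - destruct (IHHr _ _ _ _ _ Hst Hb) as (S' & v2 & v3 & σ2' & σ3' & ? & ? & ? & ? & ?).
    exists S', v2, v3, σ2', σ3'. eauto 10 using rel_conv.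
  - inversion Hb; subst. exists S, v2, v3, σ2, σ3. split; [unfold ext; auto|].
    repeat split; try (eexists; constructor); try apply Hst. apply rel_Val; auto.
  - destruct (atom_nil _ _ _ _ _ _ H1 Hr1) as (x1 & x2 & x3 & -> & -> & ->).
    destruct (atom_nil _ _ _ _ _ _ H2 Hr2) as (y1 & y2 & y3 & -> & -> & ->).
    apply op_expr_big in Hb as (-> & ->).
    exists S, (op_val Verifier o x2 y2), (op_val Ideal o x3 y3), σ2, σ3.
    split; [unfold ext; auto|]. split; [exact Hst|]. split; [|split; apply op_expr_evals].
    apply rel_Val. eapply vrel_Op; eauto.
  (* The body of [auth]: prover and verifier hash the same serialization, while the ideal run
     returns the payload. *)
  - match goal with Ha : atom "e" _ _ _, Ha' : atom "a" _ _ _ |- _ =>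
      destruct (atom_nil _ _ _ _ _ _ Ha Hr1) as (ev & ev' & ev'' & -> & -> & ->);
      destruct (atom_nil _ _ _ _ _ _ Ha' Hr2) as (a & a' & a'' & -> & -> & ->) end.
    destruct (rel_evidence _ _ _ _ _ _ _ Hr1)
      as (? & [= <-] & f & x & b & g & y & c & h & z & d & -> & -> & Hev).
    destruct (Hev _ _ _ Hr2) as (s & Hs & HP & HV & _).
    inversion Hb; subst; clear Hb.
    match goal with Hb : big _ _ (Val _) _ _ _ |- _ => inversion Hb; subst; clear Hb end.
    match goal with Hb : big _ _ (Hash _) _ _ _ |- _ => inversion Hb; subst; clear Hb end.
    match goal with Hb : big _ _ (App _ _) _ _ _ |- _ => inversion Hb; subst; clear Hb end.
    repeat match goal with Hb : big _ _ (Val _) _ _ _ |- _ => inversion Hb; subst; clear Hb end.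
    match goal with Hb : big _ _ _ _ _ _ |- _ => apply HP in Hb as ([= ->] & <-) end.
    destruct (HV σ2) as (k & Hk). destruct σ2 as [p2 h2 j2], σ3 as [p3 h3 j3].
    assert (Hj := Hst). destruct Hj as (? & ? & ? & _). cbn in *. subst.
    eapply states_hist in Hst.
    exists S. do 4 eexists. split; [unfold ext; auto|split; [exact Hst|]].
    split; [eapply rel_Val, vrel_Auth; eassumption|].
    split; eexists; [|constructor].
    eapply big_Hash, big_App; [eapply big_Fst; constructor|constructor|exact Hk].
  - discriminate.
  - inversion Hb; subst. clear IHHr. do 5 eexists. split; [|split; [exact Hst|split]].
    + unfold ext; auto.
    + apply rel_Val, vrel_Rec. exact Hr.
    + split; eexists; constructor.
  - clear IHHr1 IHHr2. inversion Hb; subst; clear Hb.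
    run e1. run a1. canon Hv.
    destruct Hv as [(f' & x' & b & b' & b'' & [= <- <- <-] & -> & -> & Hbody)|
      (c & c' & c'' & d & d' & d'' & w & E & -> & -> & Hc & Ht & Hu)].
    + specialize (Hbody _ _ _ Hv0).
      lazymatch type of Hbody with rel _ _ ?e _ _ _ => run e end.
      finish; [eassumption|econstructor; eassumption..].
    (* A partially applied [unauth] receives its second argument and becomes a suspended
       computation. *)
    + cbn in E. injection E as -> -> ->.
      match goal with Hb : big _ _ (subst' _ ?a _) ?σ _ _ |- _ =>
        assert (v = op_val Prover OUnauth2 c a /\ σ1' = σ) as (-> & ->)
          by (inversion Hb; subst; auto); clear Hb end.
      cbn in Hev, Hev0. finish.
      * eapply rel_conv; [|apply teq_sym, Hu]. apply rel_Val.
        apply (vrel_Op _ _ OUnauth2) with (1 := op_unauth2 w); [exact Hc|].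
        eapply rel_conv; eassumption.
      * eapply big_App; [eassumption|eassumption|cbn; constructor].
      * eapply big_App; [eassumption|eassumption|cbn; constructor].
  - clear IHHr. inversion Hb; subst; clear Hb. run e1.
    match goal with Ho : un_op_typed _ _ _, He : un_op_eval _ _ = _ |- _ =>
      destruct (un_op_rel _ _ _ _ _ _ _ _ Ho Hv He) as (-> & -> & ?) end.
    finish; [eassumption|econstructor; eassumption..].
  - clear IHHr1 IHHr2. inversion Hb; subst; clear Hb. run e1. run a1.
    match goal with Ho : bin_op_typed _ _ _ _, He : bin_op_eval _ _ _ = _ |- _ =>
      destruct (bin_op_rel _ _ _ _ _ _ _ _ _ _ _ _ Ho Hv Hv0 He) as (-> & -> & -> & -> & ?) end.
    finish; [eassumption|econstructor; eassumption..].
  - clear IHHr1 IHHr2 IHHr3. inversion Hb; subst; clear Hb. run e1. run a1. run b1.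
    canon Hv. destruct Hv as (? & [= <-] & -> & ->).
    canon Hv0. destruct Hv0 as (? & [= <-] & -> & ->).
    canon Hv1. destruct Hv1 as (? & [= <-] & -> & ->).
    finish; [|econstructor; eassumption..]. apply rel_Val, vrel_Lit. constructor.
  - clear IHHr1 IHHr2 IHHr3. inversion Hb; subst; clear Hb. run e1.
    canon Hv. destruct Hv as (? & [= <-] & -> & ->).
    destruct b; [run a1|run b1]; (finish; [eassumption|eapply big_If; eassumption..]).
  - clear IHHr1 IHHr2. inversion Hb; subst; clear Hb. run e1. run a1.
    finish; [apply rel_Val, vrel_Pair; eassumption|econstructor; eassumption..].
  - clear IHHr. inversion Hb; subst; clear Hb. run e1. canon Hv.
    destruct Hv as (? & ? & ? & ? & ? & ? & [= <- <-] & -> & -> & ? & ?).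
    finish; [eassumption|econstructor; eassumption..].
  - clear IHHr. inversion Hb; subst; clear Hb. run e1. canon Hv.
    destruct Hv as (? & ? & ? & ? & ? & ? & [= <- <-] & -> & -> & ? & ?).
    finish; [eassumption|econstructor; eassumption..].
  - clear IHHr. inversion Hb; subst; clear Hb. run e1.
    finish; [apply rel_Val, vrel_InjL; eassumption|econstructor; eassumption..].
  - clear IHHr. inversion Hb; subst; clear Hb. run e1.
    finish; [apply rel_Val, vrel_InjR; eassumption|econstructor; eassumption..].
  - clear IHHr1 IHHr2 IHHr3. inversion Hb; subst; clear Hb; run e1; canon Hv;
      destruct Hv as (? & ? & ? & [([= <-] & -> & -> & Hv)|([= <-] & -> & -> & Hv)]).
    + assert (Happ := rel_App _ _ _ _ _ _ _ _ _ _ _ Hr2 Hv).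
      lazymatch type of Happ with rel _ _ ?e _ _ _ => run e end.
      finish; [eassumption|eapply big_CaseL; eassumption..].
    + assert (Happ := rel_App _ _ _ _ _ _ _ _ _ _ _ Hr3 Hv).
      lazymatch type of Happ with rel _ _ ?e _ _ _ => run e end.
      finish; [eassumption|eapply big_CaseR; eassumption..].
  - clear IHHr. inversion Hb; subst; clear Hb. run e1.
    finish; [apply rel_Val, vrel_Fold; eassumption|econstructor; eassumption..].
  - clear IHHr. inversion Hb; subst; clear Hb. run e1.
    apply canonical_mu in Hv as (? & ? & ? & [= <-] & [= ->] & [= ->] & ?).
    finish; [eassumption|econstructor; eassumption..].
  - inversion Hb; subst; clear Hb. do 5 eexists. split; [|split; [exact Hst|split]].
    + unfold ext; auto.
    + apply rel_Val, vrel_TLam. exact Hr.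
    + split; eexists; constructor.
  - clear IHHr. inversion Hb; subst; clear Hb. run e1. canon Hv.
    destruct Hv as (? & ? & ? & [= <-] & -> & -> & Hv). specialize (Hv u).
    lazymatch type of Hv with rel _ _ ?e _ _ _ => run e end.
    finish; [eassumption|econstructor; eassumption..].
  - clear IHHr. inversion Hb; subst; clear Hb. run e1.
    finish; [eapply rel_Val, vrel_Pack; eassumption|econstructor; eassumption..].
  - clear IHHr1 IHHr2. inversion Hb; subst; clear Hb. run e1. canon Hv.
    destruct Hv as (? & ? & ? & u & [= <-] & -> & -> & Hv).
    apply (rel_tsubst1_upd _ _ nil_env) with (u := u) in Hr2. rewrite tsubst1_tshift in Hr2.
    assert (Hbody := rel_subst' _ _ _ _ _ _ _ _ _ _ _ _ Hr2 Hv).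
    lazymatch type of Hbody with rel _ _ ?e _ _ _ => run e end.
    finish; [eassumption|econstructor; eassumption..].
  - clear IHHr. inversion Hb; subst; clear Hb. run e1.
    (* The prover's fresh location lies outside the common domain, so the other two runs can
       allocate it as well. *)
    match goal with Hs : states ?S' (mkState ?m _ _) ?τ2 ?τ3, Hl : ?m ?l = None |- _ =>
      destruct τ2 as [p2 h2 j2], τ3 as [p3 h3 j3];
      assert (j2 = i /\ j3 = i /\ S' l = None /\ p2 l = None /\ p3 l = None)
        as (-> & -> & HS & ? & ?);
      [destruct Hs as (_ & ? & ? & Hm); cbn in *; specialize (Hm l);
       destruct (S' l); [destruct Hm as (? & ? & ? & ? & _); congruence|tauto]|] end.
    match goal with Hs : states _ (mkState _ _ ?j) _ _ |- _ =>
      assert (j = i) as -> by apply Hs;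
      eapply states_upd in Hs as (S1 & ? & Hl' & Hst'); [|left; exact HS|eassumption] end.
    finish; [apply rel_Val, vrel_Loc, Hl'|econstructor; eassumption..].
  - clear IHHr. inversion Hb; subst; clear Hb. run e1. canon Hv.
    destruct Hv as (l' & t' & [= <-] & -> & -> & Hl & Ht).
    match goal with Hs : states _ _ ?τ2 ?τ3 |- _ =>
      assert (Hm := proj2 (proj2 (proj2 Hs)) l); rewrite Hl in Hm;
      destruct Hm as (w1 & w2 & w3 & Hw1 & Hw2 & Hw3 & Hw);
      destruct τ2 as [p2 h2 j2], τ3 as [p3 h3 j3]; cbn in Hw1, Hw2, Hw3 end.
    assert (w1 = v) as -> by congruence.
    finish; [eapply rel_conv; eassumption|econstructor; eassumption..].
  - clear IHHr1 IHHr2. inversion Hb; subst; clear Hb. run e1. run a1. canon Hv.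
    destruct Hv as (l' & t' & [= <-] & -> & -> & Hl & Ht).
    match goal with Hs : states _ (mkState _ _ ?j) ?τ2 ?τ3 |- _ =>
      assert (Hm := proj2 (proj2 (proj2 Hs)) l); rewrite Hl in Hm;
      destruct Hm as (w1 & w2 & w3 & Hw1 & Hw2 & Hw3 & Hw);
      assert (Hj := Hs); destruct Hj as (? & ? & ? & _);
      destruct τ2 as [p2 h2 j2], τ3 as [p3 h3 j3]; cbn in *; subst;
      eapply states_upd in Hs as (S1 & ? & Hl' & Hst'); [|right; exact Hl|
        eapply rel_conv; [exact Hv0|apply teq_sym; exact Ht]] end.
    finish; [apply rel_Val, vrel_Lit; constructor|econstructor; eassumption..].
  - clear IHHr. inversion Hb; subst; clear Hb. run e1. canon Hv.
    destruct Hv as (? & [= <-] & -> & ->).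
    match goal with Hs : states _ (mkState _ _ ?j) ?τ2 ?τ3 |- _ =>
      destruct τ2 as [p2 h2 j2], τ3 as [p3 h3 j3];
      assert (Hj := Hs); destruct Hj as (? & ? & ? & _); cbn in *; subst;
      apply (states_hist _ _ _ _ _ _ _ (s :: h) (s :: h2) (s :: h3)) in Hs end.
    finish; [apply rel_Val, vrel_Lit; constructor|econstructor; eassumption..].
Qed.

End Simulation.

(** * Running authenticated computations *)

Fixpoint enc (ps : list string) : val :=
  match ps with
  | [] => FoldV (InjLV unitV)
  | s :: ps => FoldV (InjRV (PairV (LitV (LString s)) (enc ps)))
  end.

Section Run.
Context {I : Type} (hashf : I -> string -> string) (i : I).
Notation hash := (hashf i).
Notation rel := (rel hash).
Notation vrel := (vrel hash).
Notation vals S a b c t := (rel S nil_env (Val a) (Val b) (Val c) t).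
Notation states := (states hashf i).

Ltac inv e := match goal with Hb : big _ _ e _ _ _ |- _ => inversion Hb; subst; clear Hb end.
Ltac inv_vals :=
  repeat match goal with
  | Hb : big _ _ (Val _) _ _ _ |- _ => inversion Hb; subst; clear Hb
  | Hb : big _ _ (Rec _ _ _) _ _ _ |- _ => inversion Hb; subst; clear Hb
  | Hb : big _ _ (Fst (Val (PairV _ _))) _ _ _ |- _ => inversion Hb; subst; clear Hb
  | Hb : big _ _ (Snd (Val (PairV _ _))) _ _ _ |- _ => inversion Hb; subst; clear Hb
  end.

Ltac inv_con :=
  match goal with Hb : big _ _ ?e _ _ _ |- _ =>
    lazymatch e with
    | Pair _ _ => idtac | Fold _ => idtac | InjL _ => idtac | InjR _ => idtac
    end; inversion Hb; subst; clear Hb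
  end.

Definition only_evals (e : expr) (v : val) : Prop :=
  forall n σ w σ', big hashf n e σ w σ' -> w = v /\ σ' = σ.

(** Only the prover appends proofs, so inverting a given evaluation suffices. Arguments are
    expressions because the recursive call contains projections. *)
Lemma append_only_evals f e1 e2 ps ps' :
  only_evals f (to_val appendE) -> only_evals e1 (enc ps) -> only_evals e2 (enc ps') ->
  only_evals (App2 f e1 e2) (enc (ps ++ ps')).
Proof.
  revert f e1 e2; induction ps as [|s ps IH]; intros f e1 e2 Hf H1 H2 n σ w σ' Hb;
    inversion Hb; subst; clear Hb;
    inv (App f e1);
    match goal with Hb : big _ _ f _ _ _ |- _ => apply Hf in Hb as ([= -> -> ->] & ->) end;
    match goal with Hb : big _ _ e1 _ _ _ |- _ => apply H1 in Hb as (-> & ->) end;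
    match goal with Hb : big _ _ (subst' _ _ (subst' _ _ (Lam _ _))) _ _ _ |- _ =>
      cbn in Hb; inversion Hb; subst; clear Hb end;
    match goal with Hb : big _ _ e2 _ _ _ |- _ => apply H2 in Hb as (-> & ->) end;
    match goal with Hb : big _ _ (subst' _ _ _) _ _ _ |- _ =>
      cbn in Hb; inversion Hb; subst; clear Hb end;
    match goal with Hb : big _ _ (Unfold _) _ _ _ |- _ => inversion Hb; subst; clear Hb end;
    inv_vals;
    match goal with Hb : big _ _ (App _ _) _ _ _ |- _ => inversion Hb; subst; clear Hb end;
    inv_vals;
    match goal with Hb : big _ _ (subst' _ _ _) _ _ _ |- _ =>
      cbn in Hb; inversion Hb; subst; clear Hb end; auto.
  repeat first [inv_con | progress inv_vals].
  match goal with Hb : big _ _ (App _ _) _ _ _ |- _ => apply IH in Hb as (-> & ->); auto end.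
  - intros ? ? ? ? Hb. inversion Hb; auto.
  - intros ? ? ? ? Hb. inv_vals. auto.
  - intros ? ? ? ? Hb. inversion Hb; auto.
Qed.

Lemma evals_call f a σ v σ' : evals hashf (App (Val f) (Val a)) σ v σ' ->
  exists g x b, f = RecV g x b /\ evals hashf (call g x b a) σ v σ'.
Proof.
  intros (n & Hb). inversion Hb; subst. inv_vals. repeat eexists. eassumption.
Qed.

(** No client construct introduces the abstract type [tm t]: each of its values comes from a library
    operation. *)
Lemma canonical_tm S G v e2 e3 t : rel S G (Val v) e2 e3 (tm t) ->
  exists o v1 v2 v3 w1 w2 w3 t1 u1 t', v = op_val Prover o v1 w1 /\
    e2 = Val (op_val Verifier o v2 w2) /\ e3 = Val (op_val Ideal o v3 w3) /\
    op_typed o t1 u1 (tm t') /\ teq t' t /\ vals S v1 v2 v3 t1 /\ vals S w1 w2 w3 u1.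
Proof.
  intros Hr. destruct (rel_Val_inv _ _ _ _ _ _ _ Hr) as (v2 & v3 & t0 & -> & -> & Ht & Hv).
  destruct Hv; try match goal with Hl : lit_typed _ _ |- _ => destruct Hl end;
    try (apply teq_sim in Ht; [cbn in Ht; tauto|exact Logic.I|exact Logic.I]; fail).
  - apply teq_sim in Ht; [|apply rigid_tapps; exact Logic.I|exact Logic.I].
    apply sim_mu_headed in Ht; [destruct Ht|apply mu_headed_tapps; exact Logic.I].
  - assert (Hu : exists t', r = tm t' /\ teq t' t).
    { match goal with Ho : op_typed _ _ _ _ |- _ => destruct Ho end;
        apply teq_sim in Ht; try exact Logic.I; cbn in Ht; try tauto; repeat eexists; tauto. }
    destruct Hu as (t' & -> & ?). repeat eexists; eassumption.
Qed.

(** [rest] must be general because [bind] runs its first computation on a proof that still holds the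
    strings of the second. The verifier's result and final state do not depend on it. *)
Theorem run_simulated n : forall Σ v1 v2 v3 t, vals Σ v1 v2 v3 (tm t) ->
  forall σ1 σ2 σ3 r σ1', states Σ σ1 σ2 σ3 ->
  big hashf n (App (Val v1) (Val unitV)) σ1 r σ1' ->
  exists ps a1 a2 a3 Σ' σ2' σ3', r = PairV (enc ps) a1 /\ ext Σ Σ' /\
    states Σ' σ1' σ2' σ3' /\ vals Σ' a1 a2 a3 t /\
    (forall rest, evals hashf (App (Val v2) (Val (enc (ps ++ rest)))) σ2
      (InjRV (PairV (enc rest) a2)) σ2') /\
    evals hashf (App (Val v3) (Val unitV)) σ3 a3 σ3'.
Proof.
  induction n as [n IH] using lt_wf_ind. intros Σ v1 v2 v3 t Hv σ1 σ2 σ3 r σ1' Hst Hb.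
  apply canonical_tm in Hv
    as (o & x1 & x2 & x3 & y1 & y2 & y3 & t1 & u1 & t' & -> & [= ->] & [= ->] & Ho & Ht & Hx & Hy).
  inversion Ho; subst; clear Ho; inversion Hb; subst; clear Hb; inv_vals;
    match goal with Hb : big _ _ (subst' _ _ _) _ _ _ |- _ => cbn in Hb end.
  - repeat first [inv_con | progress inv_vals].
    eexists [], _, x2, x3, Σ, σ2, σ3.
    split; [reflexivity|]. split; [unfold ext; auto|]. split; [exact Hst|].
    split; [eapply rel_conv; eassumption|].
    split; [intros rest|]; eexists; unfold op_val; evs.
  - match goal with Hb : big _ _ (App _ _) _ _ _ |- _ => inversion Hb; subst; clear Hb end.
    inv_vals.
    match goal with Hb : big _ ?m (App (Val x1) _) _ _ _ |- _ =>
      destruct (IH m ltac:(lia) _ _ _ _ _ Hx _ _ _ _ _ Hst Hb)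
        as (ps1 & a1 & a2 & a3 & S1 & τ2 & τ3 & -> & He1 & Hst1 & Ha & HV1 & HI1);
      clear Hb Hst end.
    apply (proj1 (rel_vrel_ext hash)) with (S' := S1) in Hy; [|exact He1].
    match goal with Hb : big _ _ (subst' _ _ _) _ _ _ |- _ =>
      cbn in Hb; inversion Hb; subst; clear Hb end.
    inv_vals.
    match goal with Hb : big _ _ (App (App _ _) _) _ _ _ |- _ => inversion Hb; subst; clear Hb end.
    match goal with Hb : big _ _ (App (Val y1) _) _ _ _ |- _ => inversion Hb; subst; clear Hb end.
    inv_vals.
    assert (Happ := rel_App _ _ _ _ _ _ _ _ _ _ _ Hy Ha).
    (* The prover's call evaluates its argument first; here and below, a call on values is rebuilt
       from the body, at no larger size. *)
    match goal with Hb : big _ ?m _ _ (RecV ?f ?x ?e) ?σ |- _ =>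
      assert (Hb' := big_App _ _ _ _ _ _ _ _ _ _ _ _ _ _ _
        (big_Val hashf _ _) (big_Val hashf _ _) Hb);
      destruct (rel_simulated _ _ _ _ _ _ _ _ Happ _ _ _ _ _ Hst1 Hb')
        as (S2 & m2 & m3 & υ2 & υ3 & He2 & Hst2 & Hm & HV2 & HI2); clear Hb Hb' Hst1 end.
    match goal with Hb : big _ ?m (subst' ?x unitV _) _ _ _ |- _ =>
      assert (Hb' := big_App _ _ _ _ _ _ _ _ _ _ _ _ _ _ _
        (big_Val hashf _ _) (big_Val hashf _ _) Hb);
      destruct (IH (S (0 + 0 + m)) ltac:(lia) _ _ _ _ _ Hm _ _ _ _ _ Hst2 Hb')
        as (ps2 & b1 & b2 & b3 & S3 & ω2 & ω3 & -> & He3 & Hst3 & Hb2 & HV3 & HI3);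
      clear Hb Hb' Hst2 end.
    match goal with Hb : big _ _ (subst' _ _ _) _ _ _ |- _ =>
      cbn in Hb; inversion Hb; subst; clear Hb end.
    inv_vals.
    match goal with Hb : big _ _ (App (App _ _) _) _ _ _ |- _ =>
      apply (append_only_evals _ _ _ ps1 ps2) in Hb as (-> & ->) end.
    2-4: intros ? ? ? ? Hb; inv_vals; auto; inversion Hb; auto.
    eexists (ps1 ++ ps2)%list, _, b2, b3, S3, ω2, ω3.
    split; [reflexivity|]. split; [unfold ext in *; auto|]. split; [exact Hst3|].
    split; [eapply rel_conv; eassumption|].
    apply evals_call in HV2 as (gV & xV & bV & -> & kV & HV2).
    apply evals_call in HI2 as (gI & xI & bI & -> & kI & HI2).
    split; [intros rest; rewrite <- app_assoc|].
    + destruct (HV1 (ps2 ++ rest)%list) as (j1 & Hj1).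
      destruct (evals_call _ _ _ _ _ (HV3 rest)) as (? & ? & ? & -> & j3 & Hj3).
      unfold op_val. eexists. evs.
    + destruct HI1 as (j1 & Hj1).
      destruct (evals_call _ _ _ _ _ HI3) as (? & ? & ? & -> & j3 & Hj3).
      unfold op_val. eexists. evs.
  - destruct (rel_evidence _ _ _ _ _ _ _ Hx)
      as (? & [= <-] & f & x & b & g & y & c & h & z & d & -> & -> & Hev).
    apply canonical in Hy
      as (? & ? & [= <-] & [= <-] & a1 & a2 & a3 & s & -> & -> & -> & Ha & Hs).
    destruct (Hev _ _ _ Ha) as (s' & Hs' & HP & _ & HD).
    rewrite <- (ser_fun _ _ _ _ Hs Hs') in *. clear s' Hs'.
    repeat first [inv_con | progress inv_vals].
    match goal with Hb : big _ _ (App _ _) _ _ _ |- _ => inversion Hb; subst; clear Hb end.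
    inv_vals.
    match goal with Hb : big _ _ _ _ _ _ |- _ => apply HP in Hb as (-> & ->) end.
    destruct σ2 as [p2 h2 j2], σ3 as [p3 h3 j3]. 
    match type of Hst with states _ ?τ _ _ => destruct τ as [p1 h1 j1] end.
    assert (Hj := Hst). destruct Hj as (? & ? & ? & _). cbn in *. subst.
    destruct (HD (mkState p2 (s :: h2) i)) as (k & Hk).
    (* The verifier's history gains [s] because the check hashes the string again. *)
    eexists [s], _, a2, a3, Σ, (mkState p2 (s :: h2) i), (mkState p3 h3 i).
    split; [reflexivity|]. split; [unfold ext; auto|].
    split; [eapply states_hist, Hst|].
    split; [eapply rel_conv; eassumption|].
    split; [intros rest|]; unfold op_val.
    + assert (Heq : evals hashf (EEq (Hash (Val (lstr s))) (Val (lstr (hash s))))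
        (mkState p2 h2 i) (LitV (LBool true)) (mkState p2 (s :: h2) i)).
      { eexists. evs. cbn -[lit_eq_dec]. destruct lit_eq_dec; congruence. }
      destruct Heq as (k' & Hk'). eexists. evs.
    + eexists. evs.
Qed.

(** * The library, the client and the final result *)

Lemma rel_authentikit S G :
  rel S G AuthentikitP AuthentikitV AuthentikitI (authentikit_func_ty TUnit TBool).
Proof.
  assert (Hu : forall S G, rel S G (Val unitV) (Val unitV) (Val unitV) TUnit)
    by (intros; apply rel_Val, vrel_Lit; constructor).
  assert (Hop0 : forall o S G r, o <> OUnauth2 -> op_typed o TUnit TUnit r ->
    rel S G (op_expr Prover o (Val unitV) (Val unitV)) (op_expr Verifier o (Val unitV) (Val unitV))
      (op_expr Ideal o (Val unitV) (Val unitV)) r).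
  { intros. eapply rel_Op; eauto; constructor. }
  assert (Hop1 : forall o S G t r, o <> OUnauth2 -> op_typed o t TUnit r ->
    G (op_var1 o) = Some t ->
    rel S G (op_expr Prover o (Var (op_var1 o)) (Val unitV))
      (op_expr Verifier o (Var (op_var1 o)) (Val unitV))
      (op_expr Ideal o (Var (op_var1 o)) (Val unitV)) r).
  { intros. eapply rel_Op; eauto; try constructor; auto using rel_Var. }
  assert (Hop2 : forall o S G t u r, o <> OUnauth2 -> op_typed o t u r ->
    G (op_var1 o) = Some t -> G (op_var2 Prover o) = Some u ->
    rel S G (op_expr Prover o (Var (op_var1 o)) (Var (op_var2 Prover o)))
      (op_expr Verifier o (Var (op_var1 o)) (Var (op_var2 Prover o)))
      (op_expr Ideal o (Var (op_var1 o)) (Var (op_var2 Prover o))) r).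
  { intros. eapply rel_Op; eauto; try constructor; auto using rel_Var. }
  (* The witness [TInt] for the evidence constructor turns its applications into [tevi]. *)
  apply rel_Pair; [|apply rel_Pair; [|apply rel_Pack with TInt; cbn [tsubst tsubst1];
    repeat apply rel_Pair]].
  - apply rel_TLam, rel_Rec. apply (Hop1 ORet _ _ (TVar 0)); [discriminate|constructor|reflexivity].
  - apply rel_TLam, rel_TLam, rel_Rec, rel_Rec.
    eapply (Hop2 OBind); [discriminate|constructor|reflexivity..].
  - apply rel_TLam. apply (Hop0 OAuth); [discriminate|constructor].
  - apply rel_TLam, rel_TLam, rel_Rec, rel_Rec.
    eapply (Hop2 OPair); [discriminate|constructor|reflexivity..].
  - apply rel_TLam, rel_TLam, rel_Rec, rel_Rec.
    eapply (Hop2 OSum); [discriminate|constructor|reflexivity..].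
  - apply (Hop0 OString); [discriminate|constructor].
  - apply (Hop0 OInt); [discriminate|constructor].
  - apply rel_TLam, rel_Rec.
    eapply (Hop1 OMu); [discriminate|apply (op_mu (TVar 0))|reflexivity].
  - apply rel_TLam, rel_Rec, rel_Rec. 
    eapply rel_Auth; [apply atom_Var|apply atom_Var|apply rel_Var; reflexivity..].
  - apply rel_TLam, rel_Rec. eapply (Hop1 OUnauth1); [discriminate|constructor|reflexivity].
Qed.

(** In [client_ty] the result type sits unshifted under two type binders; being closed, it survives
    their instantiation. *)
Lemma tsubst_primitive tau s : primitive tau -> tsubst s tau = tau.
Proof. intros Hp; revert s; induction Hp; intros; cbn; f_equal; auto. Qed.

Lemma vals_primitive tau S v v2 v3 : primitive tau -> vals S v v2 v3 tau -> v2 = v /\ v3 = v.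
Proof.
  intros Hp; revert v v2 v3; induction Hp; intros v v2 v3 Hv;
    apply canonical in Hv as (? & ? & [= <-] & [= <-] & Hv).
  1-4: firstorder.
  - destruct Hv as (? & ? & ? & ? & ? & ? & -> & -> & -> & H1 & H2).
    apply IHHp1 in H1 as (-> & ->). apply IHHp2 in H2 as (-> & ->). auto.
  - destruct Hv as (? & ? & ? & [(-> & -> & -> & H1)|(-> & -> & -> & H1)]);
      [apply IHHp1 in H1 as (-> & ->)|apply IHHp2 in H1 as (-> & ->)]; auto.
Qed.

Lemma rel_client tau e : primitive tau -> typed nil nil e (client_ty tau) ->
  rel nil_env nil_env (App (TAppE (TAppE e)) AuthentikitP) (App (TAppE (TAppE e)) AuthentikitV)
    (App (TAppE (TAppE e)) AuthentikitI) (tm tau).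
Proof.
  intros Hp Ht. apply (typed_rel hash nil_env) in Ht.
  eapply rel_App; [|apply rel_authentikit].
  apply (rel_TApp _ _ _ _ _ _ _ _ TUnit) in Ht.
  apply (rel_TApp _ _ _ _ _ _ _ _ TBool) in Ht.
  unfold tsubst1 in Ht. cbn in Ht. rewrite !(tsubst_primitive tau) in Ht by exact Hp. exact Ht.
Qed.

End Run.

Theorem theorem6 :
  forall (I : Type) (hashf : I -> string -> string) (tau : ty) (e : expr),
    primitive tau ->
    typed nil nil e (client_ty tau) ->
    forall (i : I) (p v : val) (σ1 : state I),
      rtc (cf_step hashf) (prog_P e, init_state i) (Val (PairV p v), σ1) ->
      (exists σ2 : state I,
          rtc (step hashf) (prog_V e p, init_state i) (Val (InjRV v), σ2)) /\
      (exists σ3 : state I,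
          rtc (step hashf) (prog_I e, init_state i) (Val v, σ3)).
Proof.
  intros I hashf tau e Hp Ht i p v σ1 Hrtc.
  assert (Hstep : rtc (step hashf) (prog_P e, init_state i) (Val (PairV p v), σ1)).
  { clear - Hrtc. induction Hrtc as [c|c c1 c' (Hs & _) _ IH]; econstructor; eauto. }
  apply rtc_step_big with (v := PairV p v) in Hstep as (n & Hb); [|reflexivity].
  cbn [fst snd] in Hb.
  assert (Hr := rel_client hashf i tau e Hp Ht).
  unfold prog_P, runP in Hb. inversion Hb; subst; clear Hb.
  match goal with Hb : big _ _ (Lam _ _) _ _ _ |- _ => inversion Hb; subst; clear Hb end.
  match goal with Hb : big _ _ (App (TAppE _) _) _ ?w _ |- _ =>
    destruct (rel_simulated _ _ _ _ _ _ _ _ Hr _ _ _ _ _ (states_init hashf i) Hb)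
      as (S & m2 & m3 & τ2 & τ3 & _ & Hst & Hv & (k2 & HV) & (k3 & HI)) end.
  match goal with Hb : big _ _ (subst' _ _ _) _ _ _ |- _ =>
    destruct (run_simulated _ _ _ _ _ _ _ _ Hv _ _ _ _ _ Hst Hb)
      as (ps & a1 & a2 & a3 & S' & υ2 & υ3 & [= -> ->] & _ & _ & Ha & HV' & HI') end.
  apply vals_primitive in Ha as (-> & ->); auto.
  (* The top-level verifier run consumes the whole proof. *)
  specialize (HV' nil). rewrite app_nil_r in HV'.
  destruct HV' as (k2' & HV'), HI' as (k3' & HI').
  split; [exists υ2|exists υ3].
  - eapply big_rtc. unfold prog_V, App2, runV.
    eapply big_App; [eapply big_App; [constructor|exact HV|constructor]|constructor|].
    cbn. eapply big_CaseR; [exact HV'|]. evs.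
  - eapply big_rtc. unfold prog_I, runI. eapply big_App; [constructor|exact HI|exact HI'].
Qed.
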